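(* Let $A$ be a $\Delta^0_2$ set such that $A\not\leq_K\emptyset$. Then there exists a nonempty $\Pi^0_1$ class $\mathcal{P}\subseteq 2^{\omega}$ such that every $X\in\mathcal{P}$ satisfies $X\not\leq_K\emptyset$ and $A\not\leq_K X$.
   Context: Sets are identified with their binary characteristic sequences (elements of $2^\omega$); $X\restriction_n$ is the string of the first $n$ bits of $X$. $K$ denotes prefix-free Kolmogorov complexity with respect to a fixed optimal prefix-free machine. For sets $X,Y$, $X\leq_K Y$ means there is a constant $c$ with $K(X\restriction_n)\leq K(Y\restriction_n)+c$ for all $n$; thus $X\leq_K\emptyset$ means $X$ is $K$-trivial, i.e. $K(X\restriction_n)\leq K(n)+c$ for some $c$ and all $n$. A $\Pi^0_1$ class is the set of infinite paths through a computable binary tree. *)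

(* Defs.v *)
From Stdlib Require Import Arith List Classical ClassicalEpsilon.
Import ListNotations.

Inductive code : Type :=
| Zero : code
| Succ : code
| Proj : nat -> code
| Comp : code -> list code -> code
| Rec  : code -> code -> code
| Mu   : code -> code.

Inductive eval : code -> list nat -> nat -> Prop :=
| eval_zero : forall v, eval Zero v 0
| eval_succ : forall x v, eval Succ (x :: v) (S x)
| eval_proj : forall i v, i < length v -> eval (Proj i) v (nth i v 0)
| eval_comp : forall f gs v ws y,
    evals gs v ws -> eval f ws y -> eval (Comp f gs) v y
| eval_rec0 : forall f g v y, eval f v y -> eval (Rec f g) (0 :: v) y
| eval_recS : forall f g n v y z,
    eval (Rec f g) (n :: v) y -> eval g (n :: y :: v) z ->
    eval (Rec f g) (S n :: v) z
| eval_mu : forall f v n,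
    eval f (n :: v) 0 ->
    (forall m, m < n -> exists k, eval f (m :: v) (S k)) ->
    eval (Mu f) v n
with evals : list code -> list nat -> list nat -> Prop :=
| evals_nil : forall v, evals [] v []
| evals_cons : forall g gs v y ys,
    eval g v y -> evals gs v ys -> evals (g :: gs) v (y :: ys).

Definition bstring := list bool.

(* A computable bijection between binary strings and natural numbers. *)
Fixpoint enc (s : bstring) : nat :=
  match s with
  | [] => 0
  | b :: s' => if b then 2 * enc s' + 2 else 2 * enc s' + 1
  end.

Definition cantor := nat -> bool.

Definition restr (X : cantor) (n : nat) : bstring := map X (seq 0 n).

Definition emptyset : cantor := fun _ => false.

Definition prefix (s t : bstring) : Prop := exists u, t = s ++ u.

Definition runs (M : code) (p y : bstring) : Prop := eval M [enc p] (enc y).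

Definition prefix_free (M : code) : Prop :=
  forall p q y z, runs M p y -> runs M q z -> prefix p q -> p = q.

Definition optimal_pf (U : code) : Prop :=
  prefix_free U /\
  forall M, prefix_free M ->
    exists c, forall p y, runs M p y ->
      exists q, runs U q y /\ length q <= length p + c.

(* K_U(y) = min { |p| : U(p) = y } (0 if undefined, which never happens for
   optimal U). *)
Definition is_K (U : code) (y : bstring) (k : nat) : Prop :=
  (exists p, runs U p y /\ length p = k) /\
  (forall p, runs U p y -> k <= length p).

Definition K (U : code) (y : bstring) : nat :=
  epsilon (inhabits 0)
    (fun k => is_K U y k \/ (~ (exists p, runs U p y) /\ k = 0)).

Definition leK (U : code) (X Y : cantor) : Prop :=
  exists c, forall n, K U (restr X n) <= K U (restr Y n) + c.

Definition b2n (b : bool) : nat := if b then 1 else 0.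

(* Delta^0_2 : limit of a total computable approximation (Shoenfield). *)
Definition Delta02 (A : cantor) : Prop :=
  exists (g : nat -> nat -> nat) (c : code),
    (forall x s, eval c [x; s] (g x s)) /\
    (forall x, exists s0, forall s, s0 <= s -> g x s = b2n (A x)).

Definition computable_tree (T : bstring -> bool) : Prop :=
  (exists c, forall s, eval c [enc s] (b2n (T s))) /\
  (forall s t, T (s ++ t) = true -> T s = true).

(* Infinite paths through T: the Pi^0_1 class [T]. *)
Definition path (T : bstring -> bool) (X : cantor) : Prop :=
  forall n, T (restr X n) = true.

(* Main.v *)
Require Import Defs.
From Stdlib Require Import Bool Arith List Classical ClassicalEpsilon Lia Cantor.
From Stdlib Require Import FunctionalExtensionality PropExtensionality.
Import ListNotations.

(** A path of the class may be chosen freely on a block of positions [e, 3e + 1); there it is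
    kept away from the strings with a program of length at most 2e. Since the zero string of
    length 3e + 1 has complexity at most e + O(1), no path is K-trivial, and since fewer than
    2^(2e+1) strings are removed, each block keeps some value. After a block ending at l, a
    marker r >= l follows an approximation to a number n in [0, r] with
    K(A|n) > K(0^n) + 2^(l+1) + e: each time no such n seems to exist in
    [0, r], one extension per string of length l is kept, up to the current length of the
    construction, which becomes the new r, and all later blocks are cancelled. As A is
    Delta^0_2 and not K-trivial, this happens finitely often. In the limit X|n can be computed
    from n and X|l by running the construction until a marker r >= n appears, so
    K(X|n) <= K(0^n) + 2^(l+1) + O(1), which is below K(A|n) by an unbounded amount as
    blocks vary. *)

#[local] Arguments to_nat : simpl never.
#[local] Arguments of_nat : simpl never.

(** * Computable total functions *)

(** The tree has to be computable, while K is approximable only from above and [A] only in the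
    limit. Removal is safe all the same: a program seen at some stage is a real one, so no string is
    removed wrongly, and the invariant can speak of true complexity. The guess behind a marker can
    fail after having held, which is why markers move and why an older marker overrides the newer
    ones.

    Keeping one extension per string makes the bits between the end of the block and the marker a
    function of the bits before them. The decoder cannot tell which markers are final and does not
    have to: every path runs through the strings of every stage, so even a marker that is cancelled
    later decodes correctly. Permanence serves only to make the search end.

    In the gap, 2^(l+1) is the price of a crude self-delimiting code: X|l is passed by its index,
    below 2^(l+1), written in unary before a program for 0^n. The summand e outgrows the additive
    constants. The threshold 2e lies between the e + O(1) available for a zero string and the 2e + 1
    bits of a block. *)

Definition natcomp (F : nat -> nat) : Prop := exists c, forall n, eval c [n] (F n).

Lemma eval_proj' i v x : nth_error v i = Some x -> eval (Proj i) v x.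
Proof.
  intros H. replace x with (nth i v 0) by (apply nth_error_nth; exact H).
  constructor. apply nth_error_Some. congruence.
Qed.

Lemma eval_comp1 f g v a y :
  eval g v a -> eval f [a] y -> eval (Comp f [g]) v y.
Proof. intros. econstructor; [repeat econstructor|]; eassumption. Qed.

Lemma eval_comp2 f g h v a b y :
  eval g v a -> eval h v b -> eval f [a; b] y -> eval (Comp f [g; h]) v y.
Proof. intros. econstructor; [repeat econstructor|]; eassumption. Qed.

Definition add_code := Rec (Proj 0) (Comp Succ [Proj 1]).
Definition pred_code := Rec Zero (Proj 0).
Definition sub_code := Rec (Proj 0) (Comp pred_code [Proj 1]).
Definition tri_code := Rec Zero (Comp Succ [Comp add_code [Proj 0; Proj 1]]).

Fixpoint tri (n : nat) : nat := match n with 0 => 0 | S m => S (m + tri m) end.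

(* The integer part of the inverse of [tri]. *)
Fixpoint tri_root (n : nat) : nat :=
  match n with
  | 0 => 0
  | S m => (1 - (tri (S (tri_root m)) - S m)) + tri_root m
  end.

Ltac evals := repeat first
  [ eassumption
  | apply eval_zero | apply eval_succ
  | apply eval_proj'; reflexivity
  | eapply eval_comp1 | eapply eval_comp2 ].

Lemma add_codeP n x : eval add_code [n; x] (n + x).
Proof.
  induction n; simpl; [constructor; evals|].
  econstructor; [exact IHn|]. evals.
Qed.

Lemma pred_codeP n : eval pred_code [n] (pred n).
Proof.
  induction n; simpl; [constructor; evals|].
  econstructor; [exact IHn|]. evals.
Qed.

Lemma sub_codeP n x : eval sub_code [n; x] (x - n).
Proof.
  induction n; simpl; [rewrite Nat.sub_0_r; constructor; evals|].
  rewrite Nat.sub_succ_r.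
  econstructor; [exact IHn|]. evals. apply pred_codeP.
Qed.

Lemma tri_codeP n : eval tri_code [n] (tri n).
Proof.
  induction n; simpl; [constructor; evals|].
  econstructor; [exact IHn|]. evals. apply add_codeP.
Qed.

Definition one_code := Comp Succ [Zero].

Definition tri_root_code :=
  Rec Zero
    (Comp add_code
       [Comp sub_code
          [Comp sub_code [Comp Succ [Proj 0]; Comp tri_code [Comp Succ [Proj 1]]];
           one_code];
        Proj 1]).

Lemma tri_root_codeP n : eval tri_root_code [n] (tri_root n).
Proof.
  induction n; cbn [tri_root]; [constructor; evals|].
  econstructor; [exact IHn|].
  eapply eval_comp2; [| |apply add_codeP]; [|evals].
  eapply eval_comp2; [| |apply sub_codeP]; [|unfold one_code; evals].
  eapply eval_comp2; [| |apply sub_codeP]; [evals|].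
  evals. apply tri_codeP.
Qed.

Lemma tri_le m n : m <= n -> tri m <= tri n.
Proof. induction 1; simpl; lia. Qed.

Lemma tri_rootP n : tri (tri_root n) <= n < tri (S (tri_root n)).
Proof.
  induction n; [simpl; lia|].
  cbn [tri_root].
  (* Truncated subtraction acts as a test: the root grows by one exactly when [S n] reaches the next
     triangular number. *)
  destruct (le_lt_dec (tri (S (tri_root n))) (S n)) as [h|h].
  - replace (1 - (tri (S (tri_root n)) - S n)) with 1 by lia.
    change (1 + tri_root n) with (S (tri_root n)).
    split; [lia|]. simpl in *. lia.
  - replace (1 - (tri (S (tri_root n)) - S n)) with 0 by lia. simpl in *; lia.
Qed.

(** The Cantor pairing adds up its diagonal by a recursion convertible to [tri]; hence [tri_root]
    recovers the diagonal and subtraction the two components. *)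
Lemma to_nat_tri a b : to_nat (a, b) = b + tri (b + a).
Proof.
  reflexivity.
Qed.

Lemma tri_root_to_nat a b : tri_root (to_nat (a, b)) = b + a.
Proof.
  rewrite to_nat_tri. destruct (tri_rootP (b + tri (b + a))) as [h1 h2].
  destruct (lt_eq_lt_dec (tri_root (b + tri (b + a))) (b + a)) as [[h|h]|h]; auto.
  - apply (tri_le (S _)) in h. lia.
  - apply (tri_le (S _)) in h. simpl in h. lia.
Qed.

Definition pair_code :=
  Comp add_code [Proj 1; Comp tri_code [Comp add_code [Proj 1; Proj 0]]].
Definition snd_code := Comp sub_code [Comp tri_code [tri_root_code]; Proj 0].
Definition fst_code := Comp sub_code [snd_code; tri_root_code].

Lemma pair_codeP a b : eval pair_code [a; b] (to_nat (a, b)).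
Proof.
  rewrite to_nat_tri. unfold pair_code.
  eapply eval_comp2; [| |apply add_codeP]; [evals|].
  eapply eval_comp1; [|apply tri_codeP].
  eapply eval_comp2; [| |apply add_codeP]; evals.
Qed.

Lemma snd_codeP n : eval snd_code [n] (snd (of_nat n)).
Proof.
  rewrite <- (cancel_to_of n) at 1. destruct (of_nat n) as [a b]. cbn [snd].
  set (m := to_nat (a, b)).
  replace b with (m - tri (tri_root m))
    by (unfold m; rewrite tri_root_to_nat, to_nat_tri; lia).
  eapply eval_comp2; [| |apply sub_codeP]; [|evals].
  eapply eval_comp1; [apply tri_root_codeP|apply tri_codeP].
Qed.

Lemma fst_codeP n : eval fst_code [n] (fst (of_nat n)).
Proof.
  replace (fst (of_nat n)) with (tri_root n - snd (of_nat n)).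
  - eapply eval_comp2; [| |apply sub_codeP];
      [apply snd_codeP|apply tri_root_codeP].
  - rewrite <- (cancel_to_of n) at 1. destruct (of_nat n) as [a b].
    rewrite tri_root_to_nat. simpl. lia.
Qed.

Lemma natcomp_ext F G : (forall n, F n = G n) -> natcomp F -> natcomp G.
Proof. intros h [c hc]. exists c. intros n. rewrite <- h. apply hc. Qed.

Lemma natcomp_id : natcomp (fun n => n).
Proof. exists (Proj 0). intros; evals. Qed.

Lemma natcomp_const k : natcomp (fun _ => k).
Proof.
  induction k as [|k [c hc]]; [exists Zero; intros; evals|].
  exists (Comp Succ [c]). intros n. eapply eval_comp1; [apply hc|evals].
Qed.

Lemma natcomp_succ F : natcomp F -> natcomp (fun n => S (F n)).
Proof. intros [c hc]. exists (Comp Succ [c]). intros n. eapply eval_comp1; [apply hc|evals]. Qed.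

Lemma natcomp_comp F G : natcomp F -> natcomp G -> natcomp (fun n => G (F n)).
Proof.
  intros [c hc] [d hd]. exists (Comp d [c]).
  intros n. eapply eval_comp1; [apply hc|apply hd].
Qed.

Lemma natcomp_code2 F G (H : nat -> nat -> nat) h :
  (forall a b, eval h [a; b] (H a b)) ->
  natcomp F -> natcomp G -> natcomp (fun n => H (F n) (G n)).
Proof.
  intros hH [c hc] [d hd]. exists (Comp h [c; d]).
  intros n. eapply eval_comp2; [apply hc|apply hd|apply hH].
Qed.

Lemma natcomp_pair F G :
  natcomp F -> natcomp G -> natcomp (fun n => to_nat (F n, G n)).
Proof. apply natcomp_code2 with (h := pair_code) (H := fun a b => to_nat (a, b)). apply pair_codeP. Qed.

Lemma natcomp_fst : natcomp (fun n => fst (of_nat n)).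
Proof. exists fst_code. apply fst_codeP. Qed.

Lemma natcomp_snd : natcomp (fun n => snd (of_nat n)).
Proof. exists snd_code. apply snd_codeP. Qed.

Lemma natcomp_rec F G H :
  natcomp F -> natcomp G -> natcomp H ->
  natcomp (fun n => nat_rect (fun _ => nat) (F n)
                   (fun m y => G (to_nat (n, to_nat (m, y)))) (H n)).
Proof.
  intros [f hf] [g hg] [h hh].
  set (r := Rec f (Comp g [Comp pair_code [Proj 2; Comp pair_code [Proj 0; Proj 1]]])).
  exists (Comp r [h; Proj 0]). intros n.
  eapply eval_comp2; [apply hh|evals|].
  induction (H n) as [|k IH]; simpl; [constructor; apply hf|].
  econstructor; [exact IH|].
  eapply eval_comp1; [|apply hg].
  eapply eval_comp2; [evals| |apply pair_codeP].
  eapply eval_comp2; [evals|evals|apply pair_codeP].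
Qed.

(** * Computability on encoded data *)

Class Enc (A : Type) := encode : A -> nat.

#[global] Instance enc_nat : Enc nat := fun n => n.
#[global] Instance enc_bool : Enc bool := b2n.
#[global] Instance enc_prod A B `{Enc A} `{Enc B} : Enc (A * B) :=
  fun p => to_nat (encode (fst p), encode (snd p)).
(** As for booleans and lists, code 0 is one constructor and a successor the other, so a single
    branching on numbers serves all these types. *)
#[global] Instance enc_option A `{Enc A} : Enc (option A) :=
  fun o => match o with None => 0 | Some x => S (encode x) end.
Fixpoint encode_list {A} `{Enc A} (l : list A) : nat :=
  match l with [] => 0 | x :: l' => S (to_nat (encode x, encode_list l')) end.
#[global] Instance enc_list A `{Enc A} : Enc (list A) := encode_list.

(* The realizer [F] is required to be total on [nat], not only on codes, so that
   primitive recursion may run it on junk values. *)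
Definition computable {A B} `{Enc A} `{Enc B} (f : A -> B) : Prop :=
  exists F, natcomp F /\ forall a, F (encode a) = encode (f a).

Definition computable2 {A B C} `{Enc A} `{Enc B} `{Enc C} (f : A -> B -> C) : Prop :=
  computable (fun p : A * B => f (fst p) (snd p)).

Definition computable3 {A B C D} `{Enc A} `{Enc B} `{Enc C} `{Enc D}
    (f : A -> B -> C -> D) : Prop :=
  computable (fun p : A * (B * C) => f (fst p) (fst (snd p)) (snd (snd p))).

Section Closure.
Context {A : Type} `{Enc A} {B : Type} `{Enc B} {C : Type} `{Enc C} {D : Type} `{Enc D}
  {X : Type} `{Enc X}.

Lemma computable_ext (f g : A -> B) :
  (forall x, f x = g x) -> computable f -> computable g.
Proof. intros h [F [h1 h2]]. exists F. split; auto. intros a. rewrite h2, h. auto. Qed.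

Lemma computable_id : computable (fun x : A => x).
Proof. exists (fun n => n). split; [apply natcomp_id|auto]. Qed.

Lemma computable_const (b : B) : computable (fun _ : A => b).
Proof. exists (fun n => encode b). split; [apply natcomp_const|auto]. Qed.

Lemma computable_comp (f : A -> B) (g : B -> C) :
  computable g -> computable f -> computable (fun x => g (f x)).
Proof.
  intros [G [h3 h4]] [F [h1 h2]]. exists (fun n => G (F n)).
  split; [apply natcomp_comp; auto|]. intros a. rewrite h2, h4. auto.
Qed.

Lemma computable_pair (f : A -> B) (g : A -> C) :
  computable f -> computable g -> computable (fun x => (f x, g x)).
Proof.
  intros [F [h1 h2]] [G [h3 h4]]. exists (fun n => to_nat (F n, G n)).
  split; [apply natcomp_pair; auto|]. intros a. rewrite h2, h4. auto.
Qed.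

Lemma computable_fst (f : A -> B * C) : computable f -> computable (fun x => fst (f x)).
Proof.
  intros [F [h1 h2]]. exists (fun n => fst (of_nat (F n))). split.
  - apply natcomp_comp with (G := fun n => fst (of_nat n)); auto. apply natcomp_fst.
  - intros a. rewrite h2. unfold encode at 1, enc_prod. rewrite cancel_of_to. auto.
Qed.

Lemma computable_snd (f : A -> B * C) : computable f -> computable (fun x => snd (f x)).
Proof.
  intros [F [h1 h2]]. exists (fun n => snd (of_nat (F n))). split.
  - apply natcomp_comp with (G := fun n => snd (of_nat n)); auto. apply natcomp_snd.
  - intros a. rewrite h2. unfold encode at 1, enc_prod. rewrite cancel_of_to. auto.
Qed.

End Closure.

Section Closure2.
Context {A : Type} `{Enc A} {B : Type} `{Enc B} {C : Type} `{Enc C} {D : Type} `{Enc D}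
  {X : Type} `{Enc X}.

Lemma computable_app2 (g : B -> C -> D) (f1 : A -> B) (f2 : A -> C) :
  computable2 g -> computable f1 -> computable f2 -> computable (fun x => g (f1 x) (f2 x)).
Proof.
  intros hg h1 h2.
  exact (computable_comp (fun x => (f1 x, f2 x)) _ hg (computable_pair _ _ h1 h2)).
Qed.

Lemma computable_app3 (g : B -> C -> D -> X) (f1 : A -> B) (f2 : A -> C) (f3 : A -> D) :
  computable3 g -> computable f1 -> computable f2 -> computable f3 ->
  computable (fun x => g (f1 x) (f2 x) (f3 x)).
Proof.
  intros hg h1 h2 h3.
  exact (computable_comp (fun x => (f1 x, (f2 x, f3 x))) _ hg
           (computable_pair _ _ h1 (computable_pair _ _ h2 h3))).
Qed.

Lemma computable_succ : computable S.
Proof. exists S. split; [apply natcomp_succ, natcomp_id|auto]. Qed.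

Lemma computable_encode : computable (fun x : A => encode x).
Proof. exists (fun n => n). split; [apply natcomp_id|auto]. Qed.

Lemma computable_nat_rect (f : A -> B) (g : A -> nat -> B -> B) (h : A -> nat) :
  computable h -> computable f -> computable3 g ->
  computable (fun x => nat_rect (fun _ => B) (f x) (g x) (h x)).
Proof.
  intros [h' [h1 h2]] [F [f1 f2]] [G [g1 g2]].
  eexists; split; [exact (natcomp_rec F G h' f1 g1 h1)|].
  intros a. cbv beta. rewrite h2. change (encode (h a)) with (h a).
  induction (h a) as [|n IH]; cbn [nat_rect]; [apply f2|].
  rewrite IH. apply (g2 (a, (n, _))).
Qed.

(* Branching at the level of codes, from which all case analyses derive. *)
Lemma natcomp_case F G h :
  natcomp h -> natcomp F -> natcomp G ->
  natcomp (fun n => match h n with 0 => F n | S m => G (to_nat (n, m)) end).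
Proof.
  intros hh hF hG.
  apply (natcomp_ext (fun n => nat_rect (fun _ => nat) (F n)
     (fun m y => (fun p => G (to_nat (fst (of_nat p), fst (of_nat (snd (of_nat p))))))
                 (to_nat (n, to_nat (m, y)))) (h n))).
  - intros n. destruct (h n) as [|m]; cbn [nat_rect]; auto.
    cbv beta. rewrite !cancel_of_to. simpl fst; simpl snd. rewrite cancel_of_to. reflexivity.
  - apply natcomp_rec with (G := fun p => G (to_nat (fst (of_nat p), fst (of_nat (snd (of_nat p))))));
      auto.
    apply natcomp_comp with (2 := hG).
    apply natcomp_pair; [apply natcomp_fst|].
    apply natcomp_comp with (G := fun n => fst (of_nat n)); [apply natcomp_snd|apply natcomp_fst].
Qed.

Lemma computable_if (b : A -> bool) (f g : A -> B) :
  computable b -> computable f -> computable g ->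
  computable (fun x => if b x then f x else g x).
Proof.
  intros [b' [b1 b2]] [F [f1 f2]] [G [g1 g2]].
  eexists; split.
  (* [false] has code 0, so [G] is the zero branch; the other branch discards the predecessor. *)
  - refine (natcomp_case G (fun p => F (fst (of_nat p))) b' b1 g1 _).
    apply natcomp_comp; [apply natcomp_fst|exact f1].
  - intros a. simpl. rewrite b2. destruct (b a); simpl; auto.
    rewrite cancel_of_to. apply f2.
Qed.

Lemma computable_case_nat (h : A -> nat) (f : A -> B) (g : A -> nat -> B) :
  computable h -> computable f -> computable2 g ->
  computable (fun x => match h x with 0 => f x | S m => g x m end).
Proof.
  intros [h' [h1 h2]] [F [f1 f2]] [G [g1 g2]].
  eexists; split; [exact (natcomp_case F G h' h1 f1 g1)|].
  intros a. simpl. rewrite h2. change (encode (h a)) with (h a).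
  destruct (h a); auto. apply (g2 (a, n)).
Qed.

Lemma computable_case_option (h : A -> option C) (f : A -> B) (g : A -> C -> B) :
  computable h -> computable f -> computable2 g ->
  computable (fun x => match h x with Some y => g x y | None => f x end).
Proof.
  intros [h' [h1 h2]] [F [f1 f2]] [G [g1 g2]].
  eexists; split; [exact (natcomp_case F G h' h1 f1 g1)|].
  intros a. simpl. rewrite h2.
  destruct (h a) as [y|]; simpl; auto. apply (g2 (a, y)).
Qed.

Lemma computable_case_list (h : A -> list C) (f : A -> B) (g : A -> C -> list C -> B) :
  computable h -> computable f -> computable3 g ->
  computable (fun x => match h x with [] => f x | y :: l => g x y l end).
Proof.
  intros [h' [h1 h2]] [F [f1 f2]] [G [g1 g2]].
  eexists; split; [exact (natcomp_case F G h' h1 f1 g1)|].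
  intros a. simpl. rewrite h2.
  destruct (h a) as [|y l]; simpl; auto. apply (g2 (a, (y, l))).
Qed.

Lemma computable_some : computable (@Some A).
Proof. exists S. split; [apply natcomp_succ, natcomp_id|auto]. Qed.

Lemma computable_cons : computable2 (@cons A).
Proof. exists S. split; [apply natcomp_succ, natcomp_id|auto]. Qed.

End Closure2.

Create HintDb computable.
#[global] Hint Resolve computable_succ computable_some computable_cons : computable.

Ltac computable_auto := first
  [ solve [auto with computable nocore]
  | unfold bstring; solve [auto with computable nocore] ].

Ltac computable_step :=
  cbv beta;
  match goal with
  | |- computable2 ?f => first [computable_auto | unfold computable2]
  | |- computable3 ?f => first [computable_auto | unfold computable3]
  | |- computable (fun x => x) => apply computable_id
  | |- computable (fun _ => ?c) => apply computable_const
  | |- computable (fun x => (@?f x, @?g x)) => apply (computable_pair f g)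
  | |- computable (fun x => fst (@?f x)) => apply (computable_fst f)
  | |- computable (fun x => snd (@?f x)) => apply (computable_snd f)
  | |- computable (fun x => nat_rect _ _ _ _) => apply computable_nat_rect
  | |- computable (fun x => if _ then _ else _) => apply computable_if
  | |- computable (fun x => match _ with _ => _ end) =>
      first [ apply computable_if | apply computable_case_nat
            | apply computable_case_option | apply computable_case_list ]
  | |- computable (fun x => ?g (@?f1 x) (@?f2 x) (@?f3 x)) =>
      apply (computable_app3 g f1 f2 f3); [computable_auto| | |]
  | |- computable (fun x => ?g (@?f1 x) (@?f2 x)) =>
      apply (computable_app2 g f1 f2); [computable_auto| |]
  | |- computable (fun x => ?g (@?f x)) =>
      apply (computable_comp f g); [computable_auto|]
  | |- computable (fun x => @encode _ _ (@?f x)) =>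
      apply (computable_comp f (fun y => encode y)); [apply computable_encode|]
  | |- computable fst => apply (computable_fst (fun x => x))
  | |- computable snd => apply (computable_snd (fun x => x))
  | |- computable ?f => computable_auto
  end.
(* Hook for the operations on lists, for which the closure lemmas come later. *)
Ltac computable_list_step := fail.
Ltac computable := repeat first [computable_list_step | computable_step].

Section Arith.

Lemma computable_add : computable2 Nat.add.
Proof.
  exists (fun n => fst (of_nat n) + snd (of_nat n)). split.
  - apply natcomp_code2 with (H := Nat.add) (h := add_code);
      [apply add_codeP|apply natcomp_fst|apply natcomp_snd].
  - intros [a b]. unfold encode, enc_prod. rewrite cancel_of_to. auto.
Qed.

Lemma computable_sub : computable2 Nat.sub.
Proof.
  exists (fun n => fst (of_nat n) - snd (of_nat n)). split.
  - apply (natcomp_code2 (fun n => snd (of_nat n)) (fun n => fst (of_nat n))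
             (fun a b => b - a) sub_code);
      [apply sub_codeP|apply natcomp_snd|apply natcomp_fst].
  - intros [a b]. unfold encode, enc_prod. rewrite cancel_of_to. auto.
Qed.
Hint Resolve computable_add computable_sub : computable.

Lemma computable_leb : computable2 Nat.leb.
Proof.
  apply (computable_ext (fun p : nat * nat => match fst p - snd p with 0 => true | S _ => false end)).
  - intros [a b]. simpl. destruct (Nat.leb_spec a b); destruct (a - b) eqn:E; auto; lia.
  - computable.
Qed.
Hint Resolve computable_leb : computable.

Lemma computable_eqb : computable2 Nat.eqb.
Proof.
  apply (computable_ext
     (fun p : nat * nat => if fst p <=? snd p then snd p <=? fst p else false)).
  - intros [a b]. simpl. destruct (Nat.leb_spec a b), (Nat.leb_spec b a), (Nat.eqb_spec a b); auto; lia.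
  - computable.
Qed.

Lemma computable_andb : computable2 andb.
Proof. change (computable (fun p : bool * bool => if fst p then snd p else false)). computable. Qed.

Lemma computable_negb : computable negb.
Proof. change (computable (fun b : bool => if b then false else true)). computable. Qed.

End Arith.
#[global] Hint Resolve computable_add computable_sub computable_leb computable_eqb
  computable_andb computable_negb : computable.

(** * Recursion over lists *)

Section Lists.
Context {A : Type} `{Enc A} {B : Type} `{Enc B} {X : Type} `{Enc X}.

(** Provides a round count sufficient to consume a list while [length] is not yet known to be
    computable. *)
Lemma length_le_encode (l : list A) : length l <= encode l.
Proof.
  induction l as [|x l IH]; simpl; auto.
  unfold encode, enc_list in *. cbn [encode_list]. rewrite to_nat_tri. lia.
Qed.

Lemma computable_fold_left (g : X -> B -> A -> B) (f : X -> B) (l : X -> list A) :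
  computable3 g -> computable f -> computable l ->
  computable (fun x => fold_left (g x) (l x) (f x)).
Proof.
  intros hg hf hl.
  apply (computable_ext (fun x => snd (nat_rect (fun _ => (list A * B)%type) (l x, f x)
    (fun _ s => match fst s with [] => s | y :: l' => (l', g x (snd s) y) end) (encode (l x))))).
  - intros x. generalize (length_le_encode (l x)). generalize (encode (l x)) as n.
    generalize (f x) as b. generalize (l x) as l0. clear.
    intros l b n. revert l b.
    (* [nat_rect] adds its new step on the outside, whereas [fold_left] treats the head first; this
       moves one step to the inside. Rounds left over idle on the empty list. *)
    assert (shift : forall n s, nat_rect (fun _ => (list A * B)%type) s
       (fun _ s => match fst s with [] => s | y :: l' => (l', g x (snd s) y) end) (S n) =
       nat_rect (fun _ => (list A * B)%type)
        (match fst s with [] => s | y :: l' => (l', g x (snd s) y) end)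
       (fun _ s => match fst s with [] => s | y :: l' => (l', g x (snd s) y) end) n).
    { clear. induction n; intros s; [reflexivity|].
      change (nat_rect (fun _ => (list A * B)%type) ?s ?f (S ?n))
        with (f n (nat_rect (fun _ => (list A * B)%type) s f n)) at 2.
      rewrite <- IHn. reflexivity. }
    induction n as [|n IH]; intros l b hn.
    + destruct l; simpl in hn; [reflexivity|lia].
    + rewrite shift. destruct l as [|y l]; cbn [fst snd].
      * rewrite (IH [] b); auto. simpl; lia.
      * apply (IH l (g x b y)). simpl in hn. lia.
  - computable.
Qed.
End Lists.

Section Lists2.
Context {A : Type} `{Enc A} {B : Type} `{Enc B} {X : Type} `{Enc X}.

Lemma computable_rev : computable (@rev A).
Proof.
  apply (computable_ext (fun l => fold_left ((fun (_ : list A) acc x => x :: acc) l) l [])).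
  - intros l. symmetry. rewrite <- (app_nil_r (rev l)). generalize (@nil A).
    induction l as [|x l IH]; intros m; simpl; auto.
    rewrite <- IH, <- app_assoc. reflexivity.
  - apply computable_fold_left; computable.
Qed.
Hint Resolve computable_rev : computable.

(** Structural recursion is a left fold over the reversed list whose state also rebuilds the tail
    already treated. *)
Lemma computable_list_rect (f : X -> B) (g : X -> A -> list A -> B -> B) (l : X -> list A) :
  computable l -> computable f ->
  computable (fun p : X * (A * (list A * B)) =>
    g (fst p) (fst (snd p)) (fst (snd (snd p))) (snd (snd (snd p)))) ->
  computable (fun x => list_rect (fun _ => B) (f x) (g x) (l x)).
Proof.
  intros hl hf hg.
  apply (computable_ext (fun x => snd (fold_left
    ((fun x s y => (y :: fst s, g x y (fst s) (snd s))) x) (rev (l x)) ([], f x)))).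
  - intros x. cbv beta.
    enough (E : fold_left (fun s y => (y :: fst s, g x y (fst s) (snd s))) (rev (l x)) ([], f x)
            = (l x, list_rect (fun _ => B) (f x) (g x) (l x))) by (rewrite E; auto).
    induction (l x) as [|y l' IH]; simpl; auto.
    rewrite fold_left_app, IH. reflexivity.
  - apply computable_snd, computable_fold_left; computable.
    refine (computable_comp
     (fun p : X * ((list A * B) * A) => (fst p, (snd (snd p), (fst (fst (snd p)), snd (fst (snd p))))))
     _ hg _).
    computable.
Qed.
End Lists2.
#[global] Hint Resolve computable_rev : computable.

Ltac computable_list_step ::=
  cbv beta;
  match goal with |- computable (fun x => list_rect _ _ _ _) => apply computable_list_rect end.

Section Lists3.
Context {A : Type} `{Enc A} {B : Type} `{Enc B} {X : Type} `{Enc X}.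

Lemma computable_app : computable2 (@app A).
Proof.
  apply (computable_ext (fun p : list A * list A =>
    list_rect (fun _ => list A) (snd p) (fun x _ r => x :: r) (fst p))).
  - intros [l m]. induction l; simpl in *; congruence.
  - computable.
Qed.

Lemma computable_length : computable (@length A).
Proof.
  apply (computable_ext (fun l => list_rect (fun _ => nat) 0 (fun x _ r => S r) l)).
  - intros l. induction l; simpl in *; congruence.
  - computable.
Qed.

Lemma computable_skipn : computable2 (@skipn A).
Proof.
  apply (computable_ext (fun p : nat * list A =>
    nat_rect (fun _ => list A) (snd p) (fun _ l => match l with [] => [] | _ :: l' => l' end) (fst p))).
  - intros [n l]. cbn [fst snd]. induction n as [|n IH]; simpl in *; auto.
    rewrite IH. clear. revert l. induction n; intros l; destruct l; auto. apply IHn.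
  - computable.
Qed.
Hint Resolve computable_app computable_length computable_skipn : computable.

Lemma computable_firstn : computable2 (@firstn A).
Proof.
  apply (computable_ext (fun p : nat * list A =>
    rev (skipn (length (snd p) - fst p) (rev (snd p))))).
  - intros [n l]. cbn [fst snd]. symmetry. apply firstn_skipn_rev.
  - computable.
Qed.

Lemma computable_nth_error : computable2 (@nth_error A).
Proof.
  apply (computable_ext (fun p : list A * nat =>
    match skipn (snd p) (fst p) with [] => None | y :: _ => Some y end)).
  - intros [l n]. cbn [fst snd]. rewrite <- hd_error_skipn. destruct (skipn n l); auto.
  - computable.
Qed.

End Lists3.
#[global] Hint Resolve computable_app computable_length computable_skipn computable_firstn
  computable_nth_error : computable.

Section Lists4.
Context {A : Type} `{Enc A} {B : Type} `{Enc B} {X : Type} `{Enc X}.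

Lemma computable_map (f : X -> A -> B) l :
  computable2 f -> computable l -> computable (fun x => map (f x) (l x)).
Proof.
  intros hf hl.
  apply (computable_ext (fun x => list_rect (fun _ => list B) [] (fun y _ r => f x y :: r) (l x))).
  - intros x. induction (l x); simpl in *; congruence.
  - computable.
Qed.

Lemma computable_filter (f : X -> A -> bool) l :
  computable2 f -> computable l -> computable (fun x => filter (f x) (l x)).
Proof.
  intros hf hl.
  apply (computable_ext (fun x => list_rect (fun _ => list A) []
     (fun y _ r => if f x y then y :: r else r) (l x))).
  - intros x. induction (l x); simpl in *; auto.
  - computable.
Qed.

Lemma computable_flat_map (f : X -> A -> list B) l :
  computable2 f -> computable l -> computable (fun x => flat_map (f x) (l x)).
Proof.
  intros hf hl.
  apply (computable_ext (fun x => list_rect (fun _ => list B) []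
     (fun y _ r => f x y ++ r) (l x))).
  - intros x. induction (l x); simpl in *; congruence.
  - computable.
Qed.

Lemma computable_existsb (f : X -> A -> bool) l :
  computable2 f -> computable l -> computable (fun x => existsb (f x) (l x)).
Proof.
  intros hf hl.
  apply (computable_ext (fun x => list_rect (fun _ => bool) false
     (fun y _ r => if f x y then true else r) (l x))).
  - intros x. induction (l x); simpl in *; auto; destruct (f x a); auto.
  - computable.
Qed.

Lemma computable_forallb (f : X -> A -> bool) l :
  computable2 f -> computable l -> computable (fun x => forallb (f x) (l x)).
Proof.
  intros hf hl.
  apply (computable_ext (fun x => list_rect (fun _ => bool) true
     (fun y _ r => if f x y then r else false) (l x))).
  - intros x. induction (l x); simpl in *; auto; destruct (f x a); auto.
  - computable.
Qed.

Lemma computable_find (f : X -> A -> bool) l :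
  computable2 f -> computable l -> computable (fun x => find (f x) (l x)).
Proof.
  intros hf hl.
  apply (computable_ext (fun x => list_rect (fun _ => option A) None
     (fun y _ r => if f x y then Some y else r) (l x))).
  - intros x. induction (l x); simpl in *; auto; destruct (f x a); auto.
  - computable.
Qed.
End Lists4.

Ltac computable_list_step ::=
  cbv beta;
  match goal with
  | |- computable (fun x => list_rect _ _ _ _) => apply computable_list_rect
  | |- computable (fun x => map _ _) => apply computable_map
  | |- computable (fun x => filter _ _) => apply computable_filter
  | |- computable (fun x => flat_map _ _) => apply computable_flat_map
  | |- computable (fun x => existsb _ _) => apply computable_existsb
  | |- computable (fun x => forallb _ _) => apply computable_forallb
  | |- computable (fun x => find _ _) => apply computable_find
  end.

Lemma computable_seq : computable2 seq.
Proof.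
  apply (computable_ext (fun p : nat * nat =>
    nat_rect (fun _ => list nat) [] (fun n l => l ++ [fst p + n]) (snd p))).
  - intros [a n]. cbn [fst snd]. induction n as [|n IH]; auto.
    rewrite seq_S, <- IH. reflexivity.
  - computable.
Qed.

(** * Powers of two, binary strings and their enumeration *)

Definition pow2 (n : nat) : nat := nat_rect (fun _ => nat) 1 (fun _ y => y + y) n.

Lemma pow2_S n : pow2 (S n) = pow2 n + pow2 n.
Proof. reflexivity. Qed.

Lemma pow2_le m n : m <= n -> pow2 m <= pow2 n.
Proof. induction 1; rewrite ?pow2_S; lia. Qed.

Lemma computable_pow2 : computable pow2.
Proof. unfold pow2. computable. Qed.

Lemma computable_enc : computable enc.
Proof.
  apply (computable_ext (fun s => list_rect (fun _ => nat) 0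
     (fun (b : bool) _ r => if b then r + r + 2 else r + r + 1) s)).
  - intros s. induction s as [|[] s IH]; simpl in *; auto; rewrite IH; lia.
  - computable.
Qed.

(** Successor in bijective base two, least significant digit first, with [false] as digit one and
    [true] as digit two. Iterated from the empty string it inverts [enc]. *)
Definition incr (s : bstring) : bstring :=
  list_rect (fun _ => bstring) [false]
    (fun (b : bool) t r => if b then false :: r else true :: t) s.

Definition dec (n : nat) : bstring := nat_rect (fun _ => bstring) [] (fun _ => incr) n.

Lemma enc_incr s : enc (incr s) = S (enc s).
Proof.
  induction s as [|[] s IH]; unfold incr in *; simpl in *; lia.
Qed.

Lemma enc_dec n : enc (dec n) = n.
Proof. induction n; simpl; auto. rewrite enc_incr. auto. Qed.

Lemma enc_inj s t : enc s = enc t -> s = t.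
Proof.
  revert t. induction s as [|[] s IH]; intros [|[] t] h; simpl in *;
    try reflexivity; try (exfalso; lia); f_equal; apply IH; lia.
Qed.

Lemma dec_enc s : dec (enc s) = s.
Proof. apply enc_inj, enc_dec. Qed.

#[global] Hint Resolve computable_seq computable_pow2 computable_enc : computable.

Lemma computable_incr : computable incr.
Proof. unfold incr. computable. Qed.
#[global] Hint Resolve computable_incr : computable.

Lemma computable_dec : computable dec.
Proof. unfold dec. computable. Qed.
#[global] Hint Resolve computable_dec : computable.

(** Digits are at most two. The bound serves twice: it counts the programs of bounded length, and it
    limits the unary index of a prefix in the final estimate. *)
Lemma enc_bound s : S (enc s) < pow2 (S (length s)).
Proof.
  induction s as [|[] s IH]; simpl length; rewrite pow2_S in *; simpl; lia.
Qed.

Definition str_eqb (s t : bstring) : bool := enc s =? enc t.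

Lemma str_eqbP s t : str_eqb s t = true <-> s = t.
Proof.
  unfold str_eqb. rewrite Nat.eqb_eq. split; [apply enc_inj|congruence].
Qed.

Lemma computable_str_eqb : computable2 str_eqb.
Proof. unfold str_eqb. computable. Qed.
#[global] Hint Resolve computable_str_eqb : computable.

Definition strings (n : nat) : list bstring :=
  nat_rect (fun _ => list bstring) [[]]
    (fun _ l => map (cons false) l ++ map (cons true) l) n.

Lemma stringsP n s : In s (strings n) <-> length s = n.
Proof.
  revert s. induction n as [|n IH]; intros s; simpl.
  - split; [intros [<-|[]]; auto|]. destruct s; auto; discriminate.
  - rewrite in_app_iff, !in_map_iff. split.
    + intros [[t [<- h]]|[t [<- h]]]; simpl; f_equal; apply IH, h.
    + destruct s as [|[] s]; intros h; try discriminate; [right|left];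
        exists s; split; auto; apply IH; auto.
Qed.

Lemma strings_length n : length (strings n) = pow2 n.
Proof.
  induction n as [|n IH]; auto. unfold strings, bstring in *. cbn [nat_rect].
  rewrite length_app, !length_map, IH. reflexivity.
Qed.

Lemma strings_NoDup n : NoDup (strings n).
Proof.
  induction n as [|n IH]; simpl; [repeat constructor; auto|].
  apply NoDup_app.
  - apply NoDup_map_NoDup_ForallPairs; auto. intros s t h. congruence.
  - apply NoDup_map_NoDup_ForallPairs; auto. intros s t h. congruence.
  - intros s h1 h2. apply in_map_iff in h1, h2.
    destruct h1 as [t [<- _]], h2 as [t' [h _]]. discriminate.
Qed.

Lemma computable_strings : computable strings.
Proof. unfold strings. computable. Qed.
#[global] Hint Resolve computable_strings : computable.

(** * Evaluation with fuel *)

Section CodeInd.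
Variable P : code -> Prop.
Hypotheses (h0 : P Zero) (h1 : P Succ) (h2 : forall i, P (Proj i))
  (h3 : forall f gs, P f -> Forall P gs -> P (Comp f gs))
  (h4 : forall f g, P f -> P g -> P (Rec f g)) (h5 : forall f, P f -> P (Mu f)).

Fixpoint code_nested_ind (c : code) : P c :=
  match c with
  | Zero => h0
  | Succ => h1
  | Proj i => h2 i
  | Comp f gs => h3 f gs (code_nested_ind f)
      ((fix all l : Forall P l := match l with
        | [] => Forall_nil P
        | g :: l' => Forall_cons g (code_nested_ind g) (all l')
        end) gs)
  | Rec f g => h4 f g (code_nested_ind f) (code_nested_ind g)
  | Mu f => h5 f (code_nested_ind f)
  end.
End CodeInd.

(* [None]: still searching; [Some None]: a call did not return;
   [Some (Some n)]: the least zero is [n]. *)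
Definition mu_search (f : nat -> option nat) (s : nat) : option (option nat) :=
  nat_rect (fun _ => option (option nat)) None
    (fun m r => match r with
       | Some _ => r
       | None => match f m with
                 | None => Some None
                 | Some y => match y with 0 => Some (Some m) | S _ => None end
                 end
       end) s.

(** The fuel limits only the [Mu] searches and is handed on unchanged to the calls inside;
    everything else recurs on the code or on a given number. *)
Fixpoint ev (c : code) (s : nat) (v : list nat) {struct c} : option nat :=
  match c with
  | Zero => Some 0
  | Succ => match v with [] => None | x :: _ => Some (S x) end
  | Proj i => nth_error v i
  | Comp f gs =>
      match (fix evs l := match l with
             | [] => Some []
             | g :: l' =>
                 match ev g s v with
                 | None => None
                 | Some y => match evs l' with None => None | Some ys => Some (y :: ys) end
                 end
             end) gs with
      | None => None
      | Some ws => ev f s ws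
      end
  | Rec f g =>
      match v with
      | [] => None
      | n :: v' => nat_rect (fun _ => option nat) (ev f s v')
          (fun m r => match r with None => None | Some y => ev g s (m :: y :: v') end) n
      end
  | Mu f =>
      match mu_search (fun m => ev f s (m :: v)) s with
      | Some (Some n) => Some n
      | _ => None
      end
  end.

Fixpoint ev_list (gs : list code) (s : nat) (v : list nat) : option (list nat) :=
  match gs with
  | [] => Some []
  | g :: l' =>
      match ev g s v with
      | None => None
      | Some y => match ev_list l' s v with None => None | Some ys => Some (y :: ys) end
      end
  end.

Lemma ev_comp f gs s v :
  ev (Comp f gs) s v = match ev_list gs s v with None => None | Some ws => ev f s ws end.
Proof.
  simpl.
  match goal with |- match ?a with _ => _ end = _ => replace a with (ev_list gs s v); auto end.
  induction gs; simpl; auto. rewrite IHgs. reflexivity.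
Qed.

Lemma mu_search_found f s n :
  mu_search f s = Some (Some n) ->
  f n = Some 0 /\ forall m, m < n -> exists k, f m = Some (S k).
Proof.
  enough (H : match mu_search f s with
    | None => forall m, m < s -> exists k, f m = Some (S k)
    | Some None => True
    | Some (Some n) => f n = Some 0 /\ forall m, m < n -> exists k, f m = Some (S k)
    end) by (intros E; rewrite E in H; exact H).
  induction s as [|s IH]; [simpl; intros; lia|].
  change (mu_search f (S s)) with (match mu_search f s with
       | Some _ => mu_search f s
       | None => match f s with
                 | None => Some None
                 | Some y => match y with 0 => Some (Some s) | S _ => None end
                 end
       end).
  destruct (mu_search f s) as [[m|]|]; auto.
  destruct (f s) as [[|k]|] eqn:E; auto.
  intros m hm. destruct (Nat.eq_dec m s) as [->|]; eauto. apply IH; lia.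
Qed.

Lemma mu_search_complete f s n :
  f n = Some 0 -> (forall m, m < n -> exists k, f m = Some (S k)) -> n < s ->
  mu_search f s = Some (Some n).
Proof.
  intros h hlt hs.
  assert (H : forall m, m <= n -> mu_search f m = None).
  { induction m as [|m IH]; intros hm; auto.
    destruct (hlt m) as [k hk]; [lia|].
    unfold mu_search in *. simpl. rewrite IH by lia. rewrite hk. reflexivity. }
  induction hs as [|s hs IH].
  - specialize (H n (le_n n)). unfold mu_search in *. simpl. rewrite H, h. reflexivity.
  - unfold mu_search in *. simpl. rewrite IH. reflexivity.
Qed.

Lemma ev_sound c s v y : ev c s v = Some y -> eval c v y.
Proof.
  revert v y. induction c as [| |i|f gs IHf IHgs|f g IHf IHg|f IHf] using code_nested_ind; intros v y.
  - intros [= <-]. constructor.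
  - destruct v; intros [= <-]. constructor.
  - apply eval_proj'.
  - rewrite ev_comp. destruct (ev_list gs s v) as [ws|] eqn:E; [|discriminate].
    intros h. apply eval_comp with ws; auto. clear h.
    revert ws E. induction IHgs as [|g gs hg _ IH]; intros ws; simpl.
    + intros [= <-]. constructor.
    + destruct (ev g s v) eqn:Eg; [|discriminate].
      destruct (ev_list gs s v) eqn:El; [|discriminate].
      intros [= <-]. constructor; auto.
  - simpl. destruct v as [|n v]; [discriminate|]. revert y.
    induction n as [|n IH]; intros y; simpl.
    + intros h. constructor; auto.
    + destruct (nat_rect _ _ _ n) eqn:E; [|discriminate].
      intros h. econstructor; eauto.
  - simpl. destruct (mu_search _ s) as [[n|]|] eqn:E; try discriminate.
    intros [= <-]. apply mu_search_found in E. destruct E as [E1 E2].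
    constructor; auto. intros m hm. destruct (E2 m hm) as [k hk]. eauto.
Qed.

Lemma eventually_all_lt (P : nat -> nat -> Prop) n :
  (forall m, m < n -> exists s0, forall s, s0 <= s -> P m s) ->
  exists s0, forall m s, m < n -> s0 <= s -> P m s.
Proof.
  induction n as [|n IH]; intros h; [exists 0; intros; lia|].
  destruct IH as [s0 h0]; [intros; apply h; lia|].
  destruct (h n) as [s1 h1]; [lia|].
  exists (max s0 s1). intros m s hm hs.
  destruct (Nat.eq_dec m n) as [->|]; [apply h1|apply h0]; lia.
Qed.

(** Stated for all large fuels, so that finitely many evaluations combine by taking a maximum. *)
Lemma ev_complete c v y :
  eval c v y -> exists s0, forall s, s0 <= s -> ev c s v = Some y.
Proof.
  revert v y. induction c as [| |i|f gs IHf IHgs|f g IHf IHg|f IHf] using code_nested_ind; intros v y h.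
  - inversion h. exists 0. auto.
  - inversion h. exists 0. auto.
  - inversion h; subst. exists 0. simpl. intros. apply nth_error_nth'. auto.
  - inversion h as [| | |? ? ? ws ? hgs hf| | |]; subst.
    assert (exists s0, forall s, s0 <= s -> ev_list gs s v = Some ws) as [s0 h0].
    { clear h hf IHf. revert ws hgs. induction IHgs as [|g gs hg _ IH]; intros ws hgs.
      - inversion hgs. exists 0. auto.
      - inversion hgs; subst.
        destruct (hg v y0) as [s0 h0]; auto.
        destruct (IH ys) as [s1 h1]; auto.
        exists (max s0 s1). intros s hs. simpl. rewrite h0, h1 by lia. reflexivity. }
    destruct (IHf ws y) as [s1 h1]; auto.
    exists (max s0 s1). intros s hs. rewrite ev_comp, h0 by lia. apply h1. lia.
  - destruct v as [|n v]; [inversion h|].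
    revert y h. induction n as [|n IH]; intros y h; inversion h; subst.
    + destruct (IHf v y) as [s0 h0]; auto.
      exists s0. intros s hs. simpl. auto.
    + destruct (IH y0) as [s0 h0]; auto.
      destruct (IHg (n :: y0 :: v) y) as [s1 h1]; auto.
      exists (max s0 s1). intros s hs. simpl in *. rewrite h0 by lia. apply h1. lia.
  - inversion h as [| | | | | |? ? ? hf hlt]; subst.
    destruct (IHf (y :: v) 0) as [s0 h0]; auto.
    destruct (eventually_all_lt (fun m s => exists k, ev f s (m :: v) = Some (S k)) y) as [s1 h1].
    { intros m hm. destruct (hlt m hm) as [k hk].
      destruct (IHf _ _ hk) as [s2 h2]. exists s2. eauto. }
    exists (S (max y (max s0 s1))). intros s hs. simpl.
    rewrite (mu_search_complete _ s y); auto; [apply h0; lia| |lia].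
    intros m hm. apply h1; lia.
Qed.

(** Determinism is read off the evaluator: with enough fuel both values are the output of one
    function. *)
Lemma eval_fun c v y z : eval c v y -> eval c v z -> y = z.
Proof.
  intros [s hs]%ev_complete [t ht]%ev_complete.
  specialize (hs (max s t)). specialize (ht (max s t)).
  rewrite hs in ht by lia. specialize (ht ltac:(lia)). congruence.
Qed.

(** The code is fixed and only fuel and arguments are inputs, so induction on the code builds a
    separate realizer for each. *)
Lemma computable_ev c : computable2 (ev c).
Proof.
  induction c as [| |i|f gs IHf IHgs|f g IHf IHg|f IHf] using code_nested_ind.
  - unfold computable2; simpl. computable.
  - unfold computable2; simpl. computable.
  - unfold computable2; simpl. computable.
  - assert (Hgs : computable2 (ev_list gs)).
    { induction IHgs as [|g gs hg _ IH]; unfold computable2; simpl; computable. }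
    apply (computable_ext (fun p : nat * list nat =>
      match ev_list gs (fst p) (snd p) with None => None | Some ws => ev f (fst p) ws end)).
    + intros p. symmetry. apply ev_comp.
    + computable.
  - unfold computable2; simpl. computable.
  - unfold computable2; simpl. unfold mu_search. computable.
Qed.

Lemma computable_code (f : nat -> nat) : computable f -> exists c, forall n, eval c [n] (f n).
Proof. intros [F [[c hc] h]]. exists c. intros n.
  specialize (hc (encode n)). rewrite h in hc. exact hc. Qed.

Lemma computable2_code {A B} `{Enc A} `{Enc B} (f : A -> B -> nat) :
  computable2 f -> exists c, forall a b, eval c [to_nat (encode a, encode b)] (f a b).
Proof. intros [F [[c hc] h]]. exists c. intros a b.
  specialize (hc (encode (a, b))). rewrite h in hc. exact hc. Qed.

(** [Mu] finds the first stage with an output and a second code reads that output off. The converse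
    direction makes all runs of the machine known, which proofs of prefix-freeness require. *)
Lemma search_code (F : nat -> nat -> option nat) :
  computable2 F ->
  exists M, forall x y, eval M [x] y <->
    exists t, F x t = Some y /\ forall t', t' < t -> F x t' = None.
Proof.
  intros hF.
  destruct (computable2_code (fun x t => match F x t with None => 1 | Some _ => 0 end)) as [c1 h1];
    [computable|].
  destruct (computable2_code (fun x t => match F x t with None => 0 | Some y => y end)) as [c2 h2];
    [computable|].
  pose (m := Mu (Comp c1 [Comp pair_code [Proj 1; Proj 0]])).
  pose (M := Comp c2 [Comp pair_code [Proj 0; m]]).
  assert (hc1 : forall x t, eval (Comp c1 [Comp pair_code [Proj 1; Proj 0]]) [t; x]
                 (match F x t with None => 1 | Some _ => 0 end)).
  { intros x t. eapply eval_comp1; [|apply h1].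
    eapply eval_comp2; [evals|evals|apply pair_codeP]. }
  assert (hM : forall x t y, F x t = Some y -> (forall t', t' < t -> F x t' = None) ->
             eval M [x] y).
  { intros x t y ht hlt.
    replace y with (match F x t with None => 0 | Some y => y end) by (rewrite ht; auto).
    eapply eval_comp1; [|apply h2].
    eapply eval_comp2; [evals| |apply pair_codeP].
    constructor.
    - specialize (hc1 x t). rewrite ht in hc1. exact hc1.
    - intros t' h. exists 0. specialize (hc1 x t'). rewrite hlt in hc1; auto. }
  exists M. intros x y. split; [|intros [t [ht hlt]]; eauto].
  intros h.
  assert (exists t, eval m [x] t) as [t ht].
  { inversion h as [| | |? ? ? ? ? hgs _| | |]; subst.
    inversion hgs as [|? ? ? ? ? hp _]; subst.
    inversion hp as [| | |? ? ? ? ? hgs' _| | |]; subst.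
    inversion hgs' as [|? ? ? ? ? _ hgs2]; subst.
    inversion hgs2; subst. eauto. }
  inversion ht as [| | | | | |? ? ? h0 hlt]; subst.
  assert (hlt' : forall t', t' < t -> F x t' = None).
  { intros t' ht'. destruct (hlt t' ht') as [k hk].
    pose proof (eval_fun _ _ _ _ hk (hc1 x t')). destruct (F x t'); [discriminate|auto]. }
  pose proof (eval_fun _ _ _ _ h0 (hc1 x t)) as E.
  destruct (F x t) as [z|] eqn:Ez; [|discriminate].
  exists t. split; auto.
  rewrite Ez. f_equal. apply (eval_fun M [x]); eauto.
Qed.

(** * Kolmogorov complexity *)

(** A self-delimiting header: a number in unary closed by [false], with the remainder left for
    [U]. *)
Definition parse (p : bstring) : option (nat * bstring) :=
  list_rect (fun _ => option (nat * bstring)) None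
    (fun (b : bool) q r =>
       if b then match r with None => None | Some x => Some (S (fst x), snd x) end
       else Some (0, q)) p.

Lemma parseP p e q : parse p = Some (e, q) <-> p = repeat true e ++ false :: q.
Proof.
  revert e. unfold parse. induction p as [|[] p IH]; intros e; simpl.
  - split; [discriminate|]. destruct e; discriminate.
  - destruct (list_rect _ _ _ p) as [[e' q']|]; simpl; split.
    + intros [= <- <-]. simpl. f_equal. apply IH. reflexivity.
    + destruct e as [|e]; simpl; [discriminate|]. intros [= h].
      apply IH in h. injection h as <- <-. reflexivity.
    + discriminate.
    + destruct e as [|e]; simpl; [discriminate|]. intros [= h].
      apply IH in h. discriminate.
  - split.
    + intros [= <- <-]. reflexivity.
    + destruct e; simpl; intros [= ->]; reflexivity.
Qed.

Lemma computable_parse : computable parse.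
Proof. unfold parse. computable. Qed.
#[global] Hint Resolve computable_parse computable_ev : computable.

Lemma prefix_marker e q e' q' :
  prefix (repeat true e ++ false :: q) (repeat true e' ++ false :: q') ->
  e = e' /\ prefix q q'.
Proof.
  intros [u h]. rewrite <- app_assoc in h. revert e' h.
  induction e as [|e IH]; intros [|e'] h; simpl in h; try discriminate.
  - injection h as h. split; auto. exists u. auto.
  - injection h as h. destruct (IH e' h) as [-> h2]. auto.
Qed.

Section Optimal.
Variables (U : code) (hU : optimal_pf U).

(* The witnessing machine reads [1^e 0 q], runs [U] on [q] to get [z] and outputs the first
   value [D e (length z) t]. *)
Lemma describe (D : nat -> nat -> nat -> option bstring) :
  computable3 D ->
  exists c, forall e q z,
    runs U q z -> (exists t0, forall t, t0 <= t -> D e (length z) t <> None) ->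
    exists t y q', D e (length z) t = Some y /\ runs U q' y /\ length q' <= e + length q + c.
Proof.
  intros hD.
  pose (G := fun p t => match parse p with
    | None => None
    | Some x => match ev U t [enc (snd x)] with
                | None => None
                | Some w => D (fst x) (length (dec w)) t
                end
    end).
  destruct (search_code (fun i t => match G (dec i) t with None => None | Some y => Some (enc y) end))
    as [M hM].
  { unfold G. computable. }
  assert (inv : forall p y, runs M p y -> exists t e q z,
     p = repeat true e ++ false :: q /\ runs U q z /\ D e (length z) t = Some y).
  { intros p y h. apply hM in h. destruct h as [t [h _]]. rewrite dec_enc in h.
    unfold G in h. destruct (parse p) as [[e q]|] eqn:E; [|discriminate].
    simpl in h. destruct (ev U t [enc q]) as [w|] eqn:Ew; [|discriminate].
    destruct (D e (length (dec w)) t) eqn:Ed; [|discriminate].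
    injection h as h. apply enc_inj in h. subst.
    exists t, e, q, (dec w). repeat split; auto.
    - apply parseP, E.
    - unfold runs. rewrite enc_dec. apply ev_sound with t, Ew. }
  (* Inherited from [U]: comparable inputs have the same header, and then comparable remainders on
     which [U] halts. *)
  assert (pf : prefix_free M).
  { intros p p' y y' h h' hp.
    apply inv in h, h'. destruct h as (_ & e & q & z & -> & hz & _).
    destruct h' as (_ & e' & q' & z' & -> & hz' & _).
    apply prefix_marker in hp. destruct hp as [<- hp].
    f_equal. f_equal. eapply (proj1 hU); eauto. }
  destruct (proj2 hU M pf) as [c hc].
  (* The extra one pays for the [false] that closes the header. *)
  exists (c + 1). intros e q z hz [t0 h0].
  assert (exists y, runs M (repeat true e ++ false :: q) y) as [y hy].
  { destruct (ev_complete _ _ _ hz) as [s hs].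
    set (F := fun t => match G (dec (enc (repeat true e ++ false :: q))) t with
                       | None => None | Some y => Some (enc y) end).
    assert (ex : exists t, F t <> None).
    { exists (max s t0). unfold F, G. rewrite dec_enc.
      rewrite (proj2 (parseP _ e q)) by reflexivity. simpl. rewrite hs by lia.
      rewrite dec_enc. specialize (h0 (max s t0)). destruct (D _ _ _); try discriminate.
      intros _. apply h0; [lia|reflexivity]. }
    destruct (dec_inh_nat_subset_has_unique_least_element (fun t => F t <> None)) as [t [[h1 h2] _]];
      auto.
    { intros t. destruct (F t); [left; discriminate|right; auto]. }
    destruct (F t) as [i|] eqn:Ei; [|congruence].
    exists (dec i). apply hM. exists t. rewrite enc_dec. split; auto.
    intros t' ht'. destruct (F t') eqn:E; auto.
    assert (t <= t') by (apply h2; congruence). lia. }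
  destruct (hc _ _ hy) as [q' [h1 h2]].
  destruct (inv _ _ hy) as (t & e' & q2 & z' & E & hz' & hD').
  assert (h : prefix (repeat true e ++ false :: q) (repeat true e' ++ false :: q2))
    by (exists []; rewrite app_nil_r; auto).
  apply prefix_marker in h. destruct h as [<- _].
  apply app_inv_head in E. injection E as <-.
  assert (z = z') as <- by (apply enc_inj; apply (eval_fun _ _ _ _ hz hz')).
  exists t, y, q'. repeat split; auto.
  rewrite length_app, repeat_length in h2. simpl in h2. lia.
Qed.

Definition described (y : bstring) (k : nat) : Prop :=
  exists p, runs U p y /\ length p <= k.

(** On one argument [Mu (Proj 1)] searches for a zero of a function constantly equal to that
    argument. It halts on code 0 alone, so its domain is the empty string and optimality passes a
    halting run on to [U]. *)
Lemma halting_program : exists q z, runs U q z.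
Proof.
  assert (h : forall p y, runs (Mu (Proj 1)) p y -> p = []).
  { intros p y h. inversion h as [| | | | | |? ? ? h0 _]; subst.
    apply enc_inj. symmetry. apply (eval_fun _ _ _ _ h0). apply eval_proj'. reflexivity. }
  destruct (proj2 hU (Mu (Proj 1))) as [c hc].
  { intros p q y z h1 h2 _. apply h in h1, h2. congruence. }
  destruct (hc [] []) as [q [hq _]]; [|eauto].
  constructor; [evals|]. simpl. lia.
Qed.

(** The index is paid for in unary; one fixed halting program of [U] fills the rest of the input at
    constant cost. *)
Lemma described_family (f : nat -> bstring) :
  computable f -> exists c, forall e, described (f e) (e + c).
Proof.
  intros hf. destruct halting_program as [q [z hq]].
  destruct (describe (fun e _ _ => Some (f e))) as [c hc]; [computable|].
  exists (length q + c). intros e.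
  destruct (hc e q z hq) as (t & y & q' & [= <-] & h1 & h2).
  { exists 0. discriminate. }
  exists q'. split; auto. lia.
Qed.

(** Disposes of the default value in [K]: the family [dec] reaches every string, so each one has a
    program and [epsilon] picks a true minimum. *)
Lemma K_le y k : K U y <= k <-> described y k.
Proof.
  assert (is_K U y (K U y)) as [[p [hp <-]] hmin].
  { assert (ex : exists p, runs U p y).
    { destruct (described_family dec) as [c hc]; [computable|].
      destruct (hc (enc y)) as [p [hp _]]. rewrite dec_enc in hp. eauto. }
    unfold K. match goal with |- is_K U y (epsilon ?i ?P) =>
      enough (h : exists k, P k) by
        (destruct (epsilon_spec i P h) as [|[h' _]]; [auto|contradiction]) end.
    destruct (dec_inh_nat_subset_has_unique_least_element
      (fun k => exists p, runs U p y /\ length p = k)) as [k' [[h1 h2] _]].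
    - intros. apply classic.
    - destruct ex as [p hp]. eauto.
    - exists k'. left. split; eauto. }
  split; [|intros [q [hq hk]]; specialize (hmin q hq); lia].
  intros h. exists p. auto.
Qed.

Definition describedb (s : nat) (y : bstring) (k : nat) : bool :=
  existsb (fun i => (length (dec i) <=? k) &&
                    match ev U s [i] with None => false | Some w => w =? enc y end) (seq 0 s).

Lemma computable_describedb : computable3 describedb.
Proof. unfold describedb. computable. Qed.

Lemma describedb_sound s y k : describedb s y k = true -> described y k.
Proof.
  unfold describedb. rewrite existsb_exists. intros [i [_ h]].
  apply andb_prop in h. destruct h as [h1 h2]. apply Nat.leb_le in h1.
  destruct (ev U s [i]) as [w|] eqn:E; [|discriminate]. apply Nat.eqb_eq in h2. subst.
  exists (dec i). split; auto. unfold runs. rewrite enc_dec. apply ev_sound with s, E.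
Qed.

Lemma describedb_le s y k k' :
  k <= k' -> describedb s y k = true -> describedb s y k' = true.
Proof.
  unfold describedb. rewrite !existsb_exists. intros hk [i [hi h]].
  exists i. split; auto. apply andb_prop in h. destruct h as [h1 h2].
  rewrite h2, andb_true_r. apply Nat.leb_le. apply Nat.leb_le in h1. lia.
Qed.

Lemma describedb_complete y k :
  described y k -> exists s0, forall s, s0 <= s -> describedb s y k = true.
Proof.
  intros [p [hp hk]]. destruct (ev_complete _ _ _ hp) as [s0 h0].
  exists (S (max s0 (enc p))). intros s hs. apply existsb_exists.
  exists (enc p). split; [apply in_seq; lia|].
  rewrite dec_enc, h0 by lia. rewrite Nat.eqb_refl, andb_true_r. apply Nat.leb_le, hk.
Qed.

(* Counting: there are fewer programs of length at most [k] than strings [u] of length [k+1]. *)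
Lemma undescribed_extension rho k :
  exists u, length u = S k /\ ~ described (rho ++ u) k.
Proof.
  apply NNPP. intros hn.
  assert (h : forall u, exists p, length u = S k -> runs U p (rho ++ u) /\ length p <= k).
  { intros u. destruct (classic (length u = S k)) as [hl|hl]; [|exists []; tauto].
    destruct (classic (described (rho ++ u) k)) as [[p hp]|hp]; [eauto|].
    exfalso. eauto. }
  pose (f := fun u => epsilon (inhabits [])
    (fun p => length u = S k -> runs U p (rho ++ u) /\ length p <= k)).
  assert (hf : forall u, length u = S k -> runs U (f u) (rho ++ u) /\ length (f u) <= k)
    by (intros u; apply (epsilon_spec _ _ (h u))).
  (* Programs of length at most [k] have codes below 2^(k+1) - 1, one fewer than the strings of
     length k + 1; determinism of [U] makes the chosen programs distinct. *)
  assert (hle : length (map (fun u => enc (f u)) (strings (S k))) <= length (seq 0 (pow2 (S k) - 1))).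
  { apply NoDup_incl_length.
    - apply NoDup_map_NoDup_ForallPairs; [|apply strings_NoDup].
      intros u v hu hv E. apply stringsP in hu, hv.
      destruct (hf u hu) as [h1 _], (hf v hv) as [h2 _].
      unfold runs in *. rewrite E in h1.
      apply (app_inv_head rho), enc_inj. eapply eval_fun; eauto.
    - intros i hi. apply in_map_iff in hi. destruct hi as [u [<- hu]].
      apply stringsP in hu. destruct (hf u hu) as [_ hk].
      apply in_seq. pose proof (enc_bound (f u)).
      assert (pow2 (S (length (f u))) <= pow2 (S k))
        by (apply pow2_le; lia).
      lia. }
  rewrite length_map, strings_length, length_seq in hle.
  pose proof (pow2_le 0 (S k) ltac:(lia)). change (pow2 0) with 1 in *. lia.
Qed.

End Optimal.

(** * The tree construction *)

Lemma pred_ext (P Q : bstring -> Prop) : (forall s, P s <-> Q s) -> P = Q.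
Proof. intros h. apply functional_extensionality. intros s. apply propositional_extensionality, h. Qed.

Definition top (ms : list (nat * nat)) : nat := match ms with [] => 0 | m :: _ => snd m end.

Definition level (e : nat) : nat := e + (e + (e + 1)).

Section Construction.
Variable U : code.
Variable good : nat -> nat -> nat -> bool.

(* A marker [(e, r)] makes strings free on positions [e, level e) and determined by their
   first [level e] bits on positions [level e, r). Lists of markers have the latest one first. *)
Definition pass (s : nat) (ms : list (nat * nat)) (sigma : bstring) : bool :=
  forallb (fun m => negb (describedb U s (firstn (level (fst m)) sigma) (fst m + fst m))) ms.

Definition thin (l : nat) (Sigma : list bstring) : list bstring :=
  list_rect (fun _ => list bstring) []
    (fun sigma _ acc =>
       if existsb (fun tau => str_eqb (firstn l tau) (firstn l sigma)) acc
       then acc else sigma :: acc) Sigma.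

(** List recursion reaches the oldest marker first, so the scan stops at the oldest failing marker
    and returns it with its elders: this is the priority order. *)
Definition scan (s : nat) (ms : list (nat * nat)) : list (nat * nat) * bool :=
  list_rect (fun _ => (list (nat * nat) * bool)%type) ([], false)
    (fun m _ acc =>
       if snd acc then acc else (m :: fst acc, negb (good (fst m) (snd m) s))) ms.

Definition state := (list bstring * list (nat * nat))%type.

Definition prune (s : nat) (st : state) : list bstring := filter (pass s (snd st)) (fst st).

Definition extend (k : nat) (Sigma : list bstring) : list bstring :=
  flat_map (fun sigma => map (fun u => sigma ++ u) (strings k)) Sigma.

(** The appended bit makes strings grow also when a marker moves. So stage [s] decides the tree at
    length [s], and each move strictly raises the end of its marker. *)
Definition next (s : nat) (st : state) : state :=
  if snd (scan s (snd st)) then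
    match fst (scan s (snd st)) with
    | [] => st
    | m :: lo =>
        (map (fun sigma => sigma ++ [false]) (thin (level (fst m)) (prune s st)),
         (fst m, S (top (snd st))) :: lo)
    end
  else
    (* These 2e + 1 free bits lead from length e to [level e]. *)
    (extend (S (top (snd st) + top (snd st))) (prune s st),
     (top (snd st), level (top (snd st))) :: snd st).

Definition stage (s : nat) : state := nat_rect (fun _ => state) ([[]], []) next s.

Definition is_good (s : nat) (m : nat * nat) : Prop := good (fst m) (snd m) s = true.

Lemma scanP s ms :
  exists hi, ms = hi ++ fst (scan s ms) /\
    if snd (scan s ms)
    then exists m lo, fst (scan s ms) = m :: lo /\ ~ is_good s m /\ Forall (is_good s) lo
    else hi = [] /\ Forall (is_good s) ms.
Proof.
  induction ms as [|m ms IH]; simpl.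
  - exists []. auto.
  - fold (scan s ms). destruct IH as [hi [E IH]].
    destruct (snd (scan s ms)) eqn:Es; simpl; rewrite ?Es.
    + exists (m :: hi). split; [simpl; congruence|exact IH].
    + destruct IH as [-> IH]. simpl in E. rewrite <- E. simpl.
      exists []. split; auto. unfold is_good at 1 2.
      destruct (good (fst m) (snd m) s) eqn:Eg; simpl.
      * split; auto.
      * exists m, ms. split; auto. unfold is_good. rewrite Eg. split; auto.
Qed.

Lemma next_cases s st :
  (Forall (is_good s) (snd st) /\
   next s st = (extend (S (top (snd st) + top (snd st))) (prune s st),
                (top (snd st), level (top (snd st))) :: snd st)) \/
  (exists hi m lo, snd st = hi ++ m :: lo /\ ~ is_good s m /\ Forall (is_good s) lo /\
   next s st =
     (map (fun sigma => sigma ++ [false]) (thin (level (fst m)) (prune s st)),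
      (fst m, S (top (snd st))) :: lo)).
Proof.
  destruct (scanP s (snd st)) as [hi [E h]]. unfold next.
  destruct (snd (scan s (snd st))).
  - right. destruct h as (m & lo & E' & hm & hlo). rewrite E' in *. eauto 8.
  - left. tauto.
Qed.

(** * The invariant of the construction *)

Definition proj (n : nat) (P : bstring -> Prop) : bstring -> Prop :=
  fun rho => exists sigma, P sigma /\ rho = firstn n sigma.

Lemma proj_proj m n P : m <= n -> proj m (proj n P) = proj m P.
Proof.
  intros h. apply pred_ext. intros s. split.
  - intros [r [[t [ht ->]] ->]]. exists t. split; auto.
    rewrite firstn_firstn. f_equal. lia.
  - intros [t [ht ->]]. exists (firstn n t). split; [exists t; auto|].
    rewrite firstn_firstn. f_equal. lia.
Qed.

Lemma proj_full n P : (forall s, P s -> length s = n) -> proj n P = P.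
Proof.
  intros h. apply pred_ext. intros s. split.
  - intros [t [ht ->]]. rewrite <- (h t ht), firstn_all. auto.
  - intros hs. exists s. split; auto. rewrite <- (h s hs), firstn_all. auto.
Qed.

(** Older markers see only the projection to the positions before the newer block. Injectivity on
    the first [level] bits is what decoding uses; the clause after it says that no block value of
    high complexity has been lost. That clause speaks of true descriptions rather than of those
    found by a stage, hence pruning preserves it. *)
Fixpoint Inv (P : bstring -> Prop) (ms : list (nat * nat)) : Prop :=
  match ms with
  | [] => forall s, P s <-> s = []
  | m :: lo =>
      fst m = top lo /\ level (fst m) <= snd m /\
      (forall s, P s -> length s = snd m) /\
      (forall s t, P s -> P t -> firstn (level (fst m)) s = firstn (level (fst m)) t -> s = t) /\
      (forall rho u, proj (fst m) P rho -> length u = S (fst m + fst m) ->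
         ~ described U (rho ++ u) (fst m + fst m) -> proj (level (fst m)) P (rho ++ u)) /\
      Inv (proj (fst m) P) lo
  end.

Lemma Inv_nonempty P ms : Inv P ms -> exists s, P s.
Proof.
  revert P. induction ms as [|m lo IH]; intros P h.
  - exists []. apply h. reflexivity.
  - destruct h as (_ & _ & _ & _ & _ & h). destruct (IH _ h) as [s [t [ht _]]]. eauto.
Qed.

Lemma Inv_length P ms s : Inv P ms -> P s -> length s = top ms.
Proof.
  destruct ms as [|m lo]; simpl.
  - intros h hs. apply h in hs. subst. auto.
  - intros (_ & _ & h & _). apply h.
Qed.

Lemma Inv_top_app P hi lo : Inv P (hi ++ lo) -> top lo <= top (hi ++ lo).
Proof.
  revert P. induction hi as [|m hi IH]; intros P h; auto.
  destruct h as (h1 & h2 & _ & _ & _ & h3). apply IH in h3. simpl.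
  unfold level in h2. lia.
Qed.

Lemma Inv_level P ms m : Inv P ms -> In m ms -> level (fst m) <= top ms.
Proof.
  revert P. induction ms as [|m' lo IH]; intros P h [].
  - subst. apply h.
  - destruct h as (h1 & h2 & _ & _ & _ & h3). apply IH in h3; auto. simpl.
    unfold level in *. lia.
Qed.

(** Cancelling the newer markers amounts to projecting the strings. *)
Lemma Inv_app P hi lo : Inv P (hi ++ lo) -> Inv (proj (top lo) P) lo.
Proof.
  revert P. induction hi as [|m hi IH]; intros P h; simpl in h.
  - rewrite proj_full; auto. intros s hs. apply (Inv_length _ _ _ h hs).
  - destruct h as (h1 & h2 & _ & _ & _ & h3).
    pose proof (Inv_top_app _ _ _ h3). apply IH in h3.
    rewrite proj_proj in h3 by lia. exact h3.
Qed.

Lemma pass_firstn P ms s n sigma :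
  Inv P ms -> top ms <= n -> pass s ms (firstn n sigma) = pass s ms sigma.
Proof.
  intros h hn. unfold pass.
  assert (hm : forall m, In m ms -> level (fst m) <= n)
    by (intros m hm; pose proof (Inv_level _ _ _ h hm); lia).
  clear h hn. induction ms as [|m ms IH]; simpl; auto.
  rewrite IH by (intros; apply hm; simpl; auto).
  rewrite firstn_firstn, Nat.min_l by (apply hm; simpl; auto). reflexivity.
Qed.

(* Surviving on the later blocks is possible above every surviving string, since each block
   has more values than there are short programs. *)
Lemma Inv_pass P ms s : Inv P ms -> Inv (fun sigma => P sigma /\ pass s ms sigma = true) ms.
Proof.
  revert P. induction ms as [|m lo IH]; intros P h.
  - intros t. rewrite (h t). simpl. tauto.
  - pose proof h as (h1 & h2 & h3 & h4 & h5 & h6).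
    set (P1 := fun sigma => P sigma /\ pass s (m :: lo) sigma = true).
    assert (hp : forall sigma, P1 sigma <-> P sigma /\ pass s lo sigma = true /\
        describedb U s (firstn (level (fst m)) sigma) (fst m + fst m) = false).
    { intros sigma. unfold P1. simpl. rewrite andb_true_iff, negb_true_iff. tauto. }
    assert (hlo : forall sigma, pass s lo (firstn (fst m) sigma) = pass s lo sigma)
      by (intros; apply (pass_firstn _ _ _ _ _ h6); lia).
    (* The older tests read only [rho], and the newest test cannot reject [rho ++ u] because
       descriptions found at a stage are genuine. *)
    assert (rich : forall rho u, proj (fst m) P rho -> pass s lo rho = true ->
        length u = S (fst m + fst m) -> ~ described U (rho ++ u) (fst m + fst m) ->
        exists sigma, P1 sigma /\ rho ++ u = firstn (level (fst m)) sigma /\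
                      rho = firstn (fst m) sigma).
    { intros rho u hr hpass hu hd. destruct (h5 rho u hr hu hd) as [sigma [hs E]].
      assert (E' : rho = firstn (fst m) sigma).
      { assert (hr' : length rho = fst m).
        { destruct hr as [t [ht ->]]. rewrite length_firstn, (h3 t ht). unfold level in h2. lia. }
        transitivity (firstn (fst m) (rho ++ u)).
        - rewrite firstn_app, <- hr', Nat.sub_diag, firstn_all, firstn_O, app_nil_r. auto.
        - rewrite E, firstn_firstn. f_equal. unfold level. lia. }
      exists sigma. split; auto. apply hp. split; [auto|split].
      - rewrite <- hlo, <- E'. exact hpass.
      - rewrite <- E. destruct (describedb U s (rho ++ u) (fst m + fst m)) eqn:Ed; auto.
        apply describedb_sound in Ed. contradiction. }
    simpl. split; [auto|split; [auto|split; [|split; [|split]]]].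
    + intros t [ht _]. auto.
    + intros t t' [ht _] [ht' _]. auto.
    + intros rho u [t [ht ->]] hu hd. apply hp in ht. destruct ht as (ht & hpt & _).
      destruct (rich (firstn (fst m) t) u) as (sigma & hs & E & _); auto.
      * exists t. auto.
      * rewrite hlo. auto.
      * exists sigma. split; auto.
    (* Pruning commutes with projection: a prefix that passes the older tests always lifts, through
       a block value without a short program. *)
    + replace (proj (fst m) P1) with (fun rho => proj (fst m) P rho /\ pass s lo rho = true);
        [apply IH; auto|].
      apply pred_ext. intros rho. split.
      * intros [hr hpass].
        destruct (undescribed_extension U rho (fst m + fst m)) as [u [hu hd]].
        destruct (rich rho u hr hpass hu hd) as (sigma & hs & _ & E). exists sigma. auto.
      * intros [t [ht ->]]. apply hp in ht. destruct ht as (ht & hpt & _).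
        split; [exists t; auto|]. rewrite hlo. auto.
Qed.

Lemma thin_incl l Sigma sigma : In sigma (thin l Sigma) -> In sigma Sigma.
Proof.
  induction Sigma as [|tau Sigma IH]; simpl; auto. fold (thin l Sigma).
  destruct (existsb _ _); simpl; tauto.
Qed.

Lemma thin_proj l Sigma sigma :
  In sigma Sigma -> exists tau, In tau (thin l Sigma) /\ firstn l tau = firstn l sigma.
Proof.
  induction Sigma as [|tau Sigma IH]; simpl; [tauto|]. fold (thin l Sigma).
  destruct (existsb _ _) eqn:E; intros [->|h].
  - apply existsb_exists in E. destruct E as [t [h1 h2]]. apply str_eqbP in h2. eauto.
  - auto.
  - exists sigma. simpl. auto.
  - destruct (IH h) as [t [h1 h2]]. exists t. simpl. auto.
Qed.

Lemma thin_inj l Sigma sigma tau :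
  In sigma (thin l Sigma) -> In tau (thin l Sigma) -> firstn l sigma = firstn l tau -> sigma = tau.
Proof.
  induction Sigma as [|t Sigma IH]; simpl; [tauto|]. fold (thin l Sigma).
  destruct (existsb _ _) eqn:E; auto.
  assert (hn : forall x, In x (thin l Sigma) -> firstn l x <> firstn l t).
  { intros x hx Ex. enough (false = true) by discriminate. rewrite <- E.
    apply existsb_exists. exists x. split; auto. apply str_eqbP, Ex. }
  intros [->|h1] [->|h2] h; auto.
  - exfalso. apply (hn tau); auto.
  - exfalso. apply (hn sigma); auto.
Qed.

(** Thinning keeps the set of prefixes of length [level (fst m)], hence all shorter projections;
    richness and the older part of the invariant depend on these alone. *)
Lemma Inv_thin Sigma hi m lo :
  Inv (fun x => In x Sigma) (hi ++ m :: lo) ->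
  Inv (fun x => In x (map (fun sigma => sigma ++ [false]) (thin (level (fst m)) Sigma)))
      ((fst m, S (top (hi ++ m :: lo))) :: lo).
Proof.
  intros h. pose proof (Inv_app _ _ _ h) as h'.
  pose proof (Inv_top_app _ _ _ h) as hle. simpl in hle.
  set (L := top (hi ++ m :: lo)) in *.
  set (P := fun x => In x Sigma) in *.
  set (Q := fun x => In x (map _ _)).
  destruct h' as (h1 & h2 & h3 & h4 & h5 & h6). simpl in h3.
  assert (hel : fst m <= level (fst m)) by (unfold level; lia).
  assert (hlen : forall s, In s (thin (level (fst m)) Sigma) -> length s = L)
    by (intros s hs; apply (Inv_length _ _ _ h), (thin_incl _ _ _ hs)).
  assert (hf : forall s, In s (thin (level (fst m)) Sigma) ->
     firstn (level (fst m)) (s ++ [false]) = firstn (level (fst m)) s).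
  { intros s hs. rewrite firstn_app.
    replace (level (fst m) - length s) with 0 by (rewrite (hlen s hs); simpl in *; lia).
    simpl. apply app_nil_r. }
  assert (E : proj (level (fst m)) Q = proj (level (fst m)) (proj (top (m :: lo)) P)).
  { rewrite proj_proj by (simpl; lia). apply pred_ext. intros rho. split.
    - intros [s [hs ->]]. apply in_map_iff in hs. destruct hs as [t [<- ht]].
      exists t. split; [apply (thin_incl _ _ _ ht)|auto].
    - intros [s [hs ->]]. destruct (thin_proj (level (fst m)) Sigma s hs) as [t [ht Et]].
      exists (t ++ [false]). split; [apply in_map_iff; eauto|]. rewrite hf; auto. }
  assert (E' : proj (fst m) Q = proj (fst m) (proj (top (m :: lo)) P))
    by (rewrite <- (proj_proj _ _ Q hel), E, proj_proj; auto).
  simpl. split; [auto|split; [simpl in *; lia|split; [|split; [|split]]]].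
  - intros s hs. apply in_map_iff in hs. destruct hs as [t [<- ht]].
    rewrite length_app, (hlen t ht). simpl. lia.
  - intros s t hs ht. apply in_map_iff in hs, ht.
    destruct hs as [s' [<- hs]], ht as [t' [<- ht]].
    rewrite !hf by auto. intros Ef. f_equal. eapply thin_inj; eauto.
  - intros rho u. rewrite E, E'. apply h5.
  - rewrite E'. exact h6.
Qed.

Lemma in_extend k Sigma x :
  In x (extend k Sigma) <-> exists sigma u, In sigma Sigma /\ length u = k /\ x = sigma ++ u.
Proof.
  unfold extend. rewrite in_flat_map. split.
  - intros [s [hs h]]. apply in_map_iff in h. destruct h as [u [<- hu]].
    apply stringsP in hu. eauto.
  - intros (s & u & hs & hu & ->). exists s. split; auto.
    apply in_map_iff. exists u. split; auto. apply stringsP, hu.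
Qed.

Lemma Inv_extend Sigma ms :
  Inv (fun x => In x Sigma) ms ->
  Inv (fun x => In x (extend (S (top ms + top ms)) Sigma)) ((top ms, level (top ms)) :: ms).
Proof.
  intros h.
  assert (hlen : forall s, In s Sigma -> length s = top ms) by (intros s hs; apply (Inv_length _ _ _ h hs)).
  assert (hl : forall x, In x (extend (S (top ms + top ms)) Sigma) -> length x = level (top ms)).
  { intros x hx. apply in_extend in hx. destruct hx as (s & u & hs & hu & ->).
    rewrite length_app, hu, (hlen s hs). unfold level. lia. }
  assert (hpre : forall s (u : bstring), In s Sigma -> firstn (top ms) (s ++ u) = s).
  { intros s u hs. rewrite firstn_app, <- (hlen s hs), Nat.sub_diag, firstn_all, firstn_O.
    apply app_nil_r. }
  assert (E : proj (top ms) (fun x => In x (extend (S (top ms + top ms)) Sigma)) =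
              fun x => In x Sigma).
  { apply pred_ext. intros rho. split.
    - intros [x [hx ->]]. apply in_extend in hx. destruct hx as (s & u & hs & hu & ->).
      rewrite hpre; auto.
    - intros hr. destruct (undescribed_extension U rho (top ms + top ms)) as [u [hu _]].
      exists (rho ++ u). rewrite hpre by auto. split; auto.
      apply in_extend. eauto. }
  simpl. split; [auto|split; [auto|split; [auto|split; [|split]]]].
  - intros s t hs ht. apply hl in hs, ht. rewrite <- hs at 1. rewrite <- ht at 1.
    rewrite !firstn_all. auto.
  - intros rho u hr hu _. rewrite E in hr. rewrite proj_full by exact hl.
    apply in_extend. eauto.
  - rewrite E. exact h.
Qed.

Lemma Inv_prune s st :
  Inv (fun x => In x (fst st)) (snd st) -> Inv (fun x => In x (prune s st)) (snd st).
Proof.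
  intros h. apply (Inv_pass _ _ s) in h.
  replace (fun x => In x (prune s st)) with
    (fun sigma => In sigma (fst st) /\ pass s (snd st) sigma = true); auto.
  apply pred_ext. intros x. symmetry. apply filter_In.
Qed.

Lemma Inv_stage s : Inv (fun x => In x (fst (stage s))) (snd (stage s)).
Proof.
  induction s as [|s IH].
  - simpl. intros t. split; [intros [<-|[]]; auto|auto].
  - change (stage (S s)) with (next s (stage s)).
    apply (Inv_prune s) in IH.
    destruct (next_cases s (stage s)) as [[_ ->]|(hi & m & lo & E & _ & _ & ->)]; cbn [fst snd].
    + apply Inv_extend, IH.
    + rewrite E in *. apply Inv_thin, IH.
Qed.

(** * The tree and its paths *)

Definition len (s : nat) : nat := top (snd (stage s)).

Lemma stage_length s x : In x (fst (stage s)) -> length x = len s.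
Proof. apply (Inv_length _ _ _ (Inv_stage s)). Qed.

Lemma len_lt s : len s < len (S s).
Proof.
  unfold len. change (stage (S s)) with (next s (stage s)).
  destruct (next_cases s (stage s)) as [[_ ->]|(hi & m & lo & E & _ & _ & ->)]; simpl; auto.
  unfold level. lia.
Qed.

Lemma len_le s t : s <= t -> len s <= len t.
Proof. induction 1 as [|t h IH]; auto. pose proof (len_lt t). lia. Qed.

Lemma le_len s : s <= len s.
Proof. induction s; [lia|]. pose proof (len_lt s). lia. Qed.

(** Both kinds of step only extend survivors, so a string of stage [S s] testifies that its
    restriction passed the tests of stage [s]. *)
Lemma stage_prune s x :
  In x (fst (stage (S s))) -> In (firstn (len s) x) (prune s (stage s)).
Proof.
  assert (hl : forall y, In y (prune s (stage s)) -> length y = len s)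
    by (intros y hy; apply (Inv_length _ _ _ (Inv_prune s _ (Inv_stage s)) hy)).
  assert (hf : forall y (u : bstring), In y (prune s (stage s)) -> firstn (len s) (y ++ u) = y).
  { intros y u hy. rewrite firstn_app, <- (hl y hy), Nat.sub_diag, firstn_all, firstn_O.
    apply app_nil_r. }
  change (stage (S s)) with (next s (stage s)).
  destruct (next_cases s (stage s)) as [[_ ->]|(hi & m & lo & E & _ & _ & ->)]; cbn [fst].
  - intros h. apply in_extend in h. destruct h as (y & u & hy & _ & ->). rewrite hf; auto.
  - intros h. apply in_map_iff in h. destruct h as (y & <- & hy). apply thin_incl in hy.
    rewrite hf; auto.
Qed.

Lemma stage_descend s t x :
  s <= t -> In x (fst (stage t)) -> In (firstn (len s) x) (fst (stage s)).
Proof.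
  intros h. revert x. induction h as [|t h IH]; intros x hx.
  - rewrite <- (stage_length s x hx), firstn_all. auto.
  - apply stage_prune, filter_In in hx. destruct hx as [hx _]. apply IH in hx.
    rewrite firstn_firstn, Nat.min_l in hx by (apply len_le, h). exact hx.
Qed.

(** Stage [length sigma] is late enough, since its strings are at least that long. Strings discarded
    afterwards stay in the tree but have no long extensions. *)
Definition tree (sigma : bstring) : bool :=
  existsb (fun tau => str_eqb sigma (firstn (length sigma) tau)) (fst (stage (length sigma))).

Lemma treeP sigma :
  tree sigma = true <->
  exists tau, In tau (fst (stage (length sigma))) /\ sigma = firstn (length sigma) tau.
Proof.
  unfold tree. rewrite existsb_exists. split; intros [t [h1 h2]]; exists t; split; auto;
    apply str_eqbP; auto.
Qed.

Lemma tree_closed s t : tree (s ++ t) = true -> tree s = true.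
Proof.
  rewrite !treeP. rewrite length_app. intros [x [hx E]].
  exists (firstn (len (length s)) x). split.
  - apply stage_descend with (2 := hx). lia.
  - rewrite firstn_firstn, Nat.min_l by apply le_len.
    transitivity (firstn (length s) (s ++ t)).
    + rewrite firstn_app, Nat.sub_diag, firstn_all, firstn_O, app_nil_r. auto.
    + rewrite E, firstn_firstn. f_equal. lia.
Qed.

Lemma tree_infinite n : exists s, length s = n /\ tree s = true.
Proof.
  destruct (Inv_nonempty _ _ (Inv_stage n)) as [x hx].
  assert (hl : length (firstn n x) = n).
  { rewrite length_firstn, (stage_length n x hx). pose proof (le_len n). lia. }
  exists (firstn n x). split; auto. apply treeP. rewrite hl. eauto.
Qed.

Lemma restr_length X n : length (restr X n) = n.
Proof. unfold restr. rewrite length_map, length_seq. auto. Qed.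

Lemma firstn_restr X m n : m <= n -> firstn m (restr X n) = restr X m.
Proof.
  intros h. replace n with (m + (n - m)) by lia. unfold restr at 1.
  rewrite seq_app, map_app. fold (restr X m).
  rewrite firstn_app, restr_length, Nat.sub_diag, firstn_O, app_nil_r.
  rewrite <- (restr_length X m) at 1. apply firstn_all.
Qed.

(** The tree judges a string of length [len s] at stage [len s], which is not before [s]; descending
    to [s] gives membership. *)
Lemma path_stage X s : path tree X -> In (restr X (len s)) (fst (stage s)).
Proof.
  intros h. specialize (h (len s)). apply treeP in h. rewrite restr_length in h.
  destruct h as [x [hx ->]]. apply stage_descend with (2 := hx). apply le_len.
Qed.

Lemma path_not_described X s m :
  path tree X -> In m (snd (stage s)) ->
  describedb U s (restr X (level (fst m))) (fst m + fst m) = false.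
Proof.
  intros h hm. pose proof (path_stage X (S s) h) as hx.
  apply stage_prune, filter_In in hx. destruct hx as [_ hx].
  rewrite firstn_restr in hx by (pose proof (len_lt s); lia).
  unfold pass in hx. rewrite forallb_forall in hx. specialize (hx m hm).
  rewrite firstn_restr in hx by (apply (Inv_level _ _ _ (Inv_stage s) hm)).
  apply negb_true_iff, hx.
Qed.

(** Holds for every marker present at the stage, whether or not it stays: the path has its own
    restriction among the strings of the stage, and injectivity identifies it with [sigma] up to the
    marker. *)
Lemma path_decode X s m sigma n :
  path tree X -> In m (snd (stage s)) -> In sigma (fst (stage s)) ->
  restr X (level (fst m)) = firstn (level (fst m)) sigma -> n <= snd m ->
  restr X n = firstn n sigma.
Proof.
  intros h hm hs E hn. pose proof (path_stage X s h) as hx.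
  pose proof (Inv_stage s) as hI. apply in_split in hm. destruct hm as (hi & lo & Em).
  pose proof (stage_length s _ hx) as hl. unfold len in *.
  rewrite Em in hI. pose proof (Inv_top_app _ _ _ hI) as htop. rewrite <- Em in htop.
  apply Inv_app in hI. destruct hI as (_ & h2 & _ & h4 & _ & _). simpl in *.
  specialize (h4 (firstn (snd m) (restr X (top (snd (stage s))))) (firstn (snd m) sigma)).
  rewrite !firstn_firstn, !Nat.min_l in h4 by lia.
  rewrite !firstn_restr in h4 by lia.
  rewrite <- (firstn_restr X n (snd m)) by lia. rewrite h4; auto.
  - rewrite firstn_firstn, Nat.min_l by lia. auto.
  - eexists; split; [exact hx|]. rewrite firstn_restr; auto.
  - eexists; split; [exact hs|]. reflexivity.
Qed.

(** * Finite injury: markers that become permanent *)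

Hypothesis good_eventually : forall e, exists n s0, forall r s,
  n <= r -> s0 <= s -> good e r s = true.

Definition permanent (F : list (nat * nat)) : Prop :=
  exists s0, forall s, s0 <= s ->
    (exists hi, snd (stage s) = hi ++ F) /\ Forall (is_good s) F.

(** The oldest failing marker, if any, lies outside [F]; the step leaves [F] in place and puts a new
    or moved marker above it. *)
Lemma markers_next s hi F :
  snd (stage s) = hi ++ F -> Forall (is_good s) F ->
  exists m hi', snd (stage (S s)) = m :: hi' ++ F.
Proof.
  intros E hF. change (stage (S s)) with (next s (stage s)).
  destruct (next_cases s (stage s)) as [[_ ->]|(hi0 & m & lo & E' & hm & _ & ->)]; cbn [snd].
  - rewrite E. eauto.
  - rewrite E in E'. apply app_eq_app in E'.
    destruct E' as [l [[-> E']|[-> ->]]].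
    + destruct l as [|m' l]; simpl in E'.
      * subst. inversion hF; contradiction.
      * injection E' as -> ->. eauto.
    + apply Forall_app in hF. destruct hF as [_ hF]. inversion hF; contradiction.
Qed.

Lemma marker_moves s hi m F :
  snd (stage s) = hi ++ m :: F -> Forall (is_good s) F -> ~ is_good s m ->
  exists r, snd m < r /\ snd (stage (S s)) = (fst m, r) :: F.
Proof.
  intros E hF hm. pose proof (Inv_stage s) as hI. rewrite E in hI.
  apply Inv_top_app in hI. rewrite <- E in hI. simpl in hI.
  exists (S (len s)). split; [unfold len; lia|].
  change (stage (S s)) with (next s (stage s)).
  destruct (next_cases s (stage s)) as [[h _]|(hi0 & m' & lo & E' & hm' & hlo & ->)]; cbn [snd].
  - rewrite E in h. apply Forall_app in h. destruct h as [_ h]. inversion h. contradiction.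
  - rewrite E in E'. apply app_eq_app in E'.
    destruct E' as [l [[-> E']|[-> E']]]; destruct l as [|m1 l]; simpl in E';
      injection E' as -> ->; auto.
    + apply Forall_app in hlo. destruct hlo as [_ h]. inversion h. contradiction.
    + apply Forall_app in hF. destruct hF as [_ h]. inversion h. contradiction.
Qed.

Lemma app_last_cons {T} (m : T) hi F : exists hi' m', m :: hi ++ F = hi' ++ m' :: F.
Proof.
  destruct (exists_last (l := m :: hi)) as [hi' [m' E]]; [discriminate|].
  exists hi', m'. change (m :: hi ++ F) with ((m :: hi) ++ F). rewrite E, <- app_assoc. auto.
Qed.

(** Above a permanent [F] the next block always starts at [top F], and its marker moves only upward.
    It settles at the latest once its end reaches the bound from [good_eventually]. *)
Lemma permanent_cons F : permanent F -> exists m, permanent (m :: F).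
Proof.
  intros [s0 h0].
  assert (hF : forall s, s0 <= s -> Forall (is_good s) F) by (intros s hs; apply h0, hs).
  destruct (good_eventually (top F)) as (n & s1 & h1).
  pose (at_ := fun s r => exists hi, snd (stage s) = hi ++ (top F, r) :: F).
  assert (keep : forall s r, s0 <= s -> at_ s r -> good (top F) r s = true -> at_ (S s) r).
  { intros s r hs [hi E] hg.
    destruct (markers_next s hi ((top F, r) :: F) E) as (m & hi' & E'); [constructor; auto|].
    exists (m :: hi'). exact E'. }
  (* Induction on the distance of [r] to that bound: either the marker fails at some later stage and
     moves closer, or it holds forever. *)
  assert (limit : forall k s r, s0 <= s -> s1 <= s -> at_ s r -> n - r <= k ->
     exists t r', s <= t /\ at_ t r' /\ forall t', t <= t' -> good (top F) r' t' = true).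
  { induction k as [|k IH]; intros s r hs hs1 hat hk.
    - exists s, r. split; [auto|split; auto]. intros t' ht. apply h1; lia.
    - destruct (classic (exists t, s <= t /\ at_ t r /\ good (top F) r t = false))
        as [(t & ht & [hi E] & hg)|hn].
      + destruct (marker_moves t hi (top F, r) F E) as (r' & hr & E').
        * apply hF. lia.
        * unfold is_good. simpl. congruence.
        * destruct (IH (S t) r') as (t' & r'' & h2 & h3 & h4); try lia.
          { exists []. exact E'. }
          { simpl in hr. lia. }
          exists t', r''. split; [lia|auto].
      + assert (hall : forall t, s <= t -> at_ t r /\ good (top F) r t = true).
        { induction 1 as [|t ht [IH1 IH2]].
          - split; auto. destruct (good (top F) r s) eqn:E; auto. exfalso. eauto.
          - assert (hat' : at_ (S t) r) by (apply keep; auto; lia).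
            split; auto. destruct (good (top F) r (S t)) eqn:E; auto.
            exfalso. apply hn. exists (S t). split; auto. }
        exists s, r. split; [auto|split; auto]. intros t' ht. apply hall, ht. }
  pose (a := max s0 s1).
  (* Some marker stands above [F] one stage later; the lowest of these starts at [top F] by the
     invariant. *)
  assert (start : exists r, at_ (S a) r).
  { destruct (h0 a) as [[hi E] hg]; [lia|].
    destruct (markers_next a hi F E hg) as (m & hi' & E').
    destruct (app_last_cons m hi' F) as (hi2 & m2 & E2). rewrite E2 in E'.
    exists (snd m2), hi2. rewrite E'. f_equal. f_equal.
    pose proof (Inv_stage (S a)) as hI. rewrite E' in hI. apply Inv_app in hI.
    destruct hI as [hI _]. rewrite <- hI. destruct m2. reflexivity. }
  destruct start as [r hr].
  destruct (limit (n - r) (S a) r) as (t & r' & h2 & h3 & h4); auto; try lia.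
  exists (top F, r'), t. intros s hs.
  split; [|constructor; [apply h4, hs|apply hF; lia]].
  change (at_ s r'). induction hs; auto. apply keep; auto. lia.
Qed.

Lemma permanent_length k : exists F, length F = k /\ permanent F.
Proof.
  induction k as [|k [F [hk hF]]].
  - exists []. split; auto. exists 0. intros s _. split; auto.
    exists (snd (stage s)). symmetry. apply app_nil_r.
  - destruct (permanent_cons F hF) as [m hm]. exists (m :: F). simpl. auto.
Qed.

(** Makes the starts of permanent markers unbounded: a marker above [k] others starts at position
    [k] or later. *)
Lemma Inv_length_le P ms : Inv P ms -> length ms <= top ms.
Proof.
  revert P. induction ms as [|m lo IH]; intros P h; auto.
  destruct h as (h1 & h2 & _ & _ & _ & h3). apply IH in h3. simpl.
  unfold level in h2. lia.
Qed.

Lemma permanent_marker k :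
  exists e r s0, k <= e /\
    forall s, s0 <= s -> In (e, r) (snd (stage s)) /\ good e r s = true.
Proof.
  destruct (permanent_length (S k)) as [[|[e r] F] [hk [s0 h0]]]; [discriminate|].
  injection hk as hk. exists e, r, s0. split.
  - destruct (h0 s0) as [[hi E] _]; auto. pose proof (Inv_stage s0) as hI. rewrite E in hI.
    apply Inv_app in hI. destruct hI as (h1 & _ & _ & _ & _ & h2).
    apply Inv_length_le in h2. simpl in *. lia.
  - intros s hs. destruct (h0 s hs) as [[hi E] hg]. split.
    + rewrite E. apply in_elt.
    + inversion hg. auto.
Qed.

End Construction.

(** * Paths through infinite binary trees *)

Lemma konig (T : bstring -> bool) :
  (forall s t, T (s ++ t) = true -> T s = true) ->
  (forall n, exists s, length s = n /\ T s = true) ->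
  exists X, path T X.
Proof.
  intros hT hinf.
  pose (big := fun s => forall n, exists t, length t = n /\ T (s ++ t) = true).
  assert (hbig : forall s, big s -> ~ big (s ++ [false]) -> big (s ++ [true])).
  { intros s hs hn n. apply not_all_ex_not in hn. destruct hn as [m hm].
    (* One long extension serves both lengths: cut to [m] it excludes the first bit [false], cut to
       [n] it is the extension wanted above [true]. *)
    destruct (hs (S (max m n))) as [[|b t] [hl ht]]; [discriminate|].
    injection hl as hl.
    assert (cut : forall j, j <= max m n ->
              exists t', length t' = j /\ T ((s ++ [b]) ++ t') = true).
    { intros j hj. exists (firstn j t). split; [rewrite length_firstn; lia|].
      apply hT with (t := skipn j t). rewrite <- app_assoc, firstn_skipn, <- app_assoc. exact ht. }
    destruct b; [apply cut; lia|]. exfalso. apply hm, cut. lia. }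
  pose (bit := fun s => if excluded_middle_informative (big (s ++ [false])) then false else true).
  pose (p := fun n => nat_rect (fun _ => bstring) [] (fun _ s => s ++ [bit s]) n).
  assert (hp : forall n, big (p n)).
  { induction n as [|n IH]; [exact hinf|]. simpl. fold (p n). unfold bit.
    destruct (excluded_middle_informative _); auto. }
  exists (fun n => bit (p n)).
  assert (E : forall n, restr (fun n => bit (p n)) n = p n).
  { induction n as [|n IH]; auto. unfold restr in *. rewrite seq_S, map_app, IH. reflexivity. }
  intros n. rewrite E. destruct (hp n 0) as [t [_ ht]]. eapply hT, ht.
Qed.

#[global] Hint Resolve computable_describedb : computable.

(** * Computability of the tree and decoding of its paths *)

Section TreeComputable.
Variables (U : code) (good : nat -> nat -> nat -> bool).
Hypothesis hgood : computable3 good.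

Lemma computable_level : computable level.
Proof. unfold level. computable. Qed.
Hint Resolve computable_level : computable.

Lemma computable_pass : computable3 (pass U).
Proof. unfold pass. computable. Qed.
Hint Resolve computable_pass : computable.

Lemma computable_thin : computable2 thin.
Proof. unfold thin. computable. Qed.
Hint Resolve computable_thin : computable.

Lemma computable_scan : computable2 (scan good).
Proof. unfold scan. computable. Qed.
Hint Resolve computable_scan : computable.

Lemma computable_prune : computable2 (prune U).
Proof. unfold prune. computable. Qed.
Hint Resolve computable_prune : computable.

Lemma computable_extend : computable2 extend.
Proof. unfold extend. computable. Qed.
Hint Resolve computable_extend : computable.

Lemma computable_top : computable top.
Proof. unfold top. computable. Qed.
Hint Resolve computable_top : computable.

Lemma computable_next : computable2 (next U good).
Proof. unfold next. computable. Qed.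
Hint Resolve computable_next : computable.

Lemma computable_stage : computable (stage U good).
Proof. unfold stage. computable. Qed.
Hint Resolve computable_stage : computable.

Lemma computable_tree_fun : computable (tree U good).
Proof. unfold tree. computable. Qed.

Lemma tree_computable : computable_tree (tree U good).
Proof.
  split.
  - destruct (computable_code (fun n => encode (tree U good (dec n)))) as [c hc].
    + pose proof computable_tree_fun. computable.
    + exists c. intros s. specialize (hc (enc s)). rewrite dec_enc in hc. exact hc.
  - intros s t. apply (tree_closed U good).
Qed.

(* Recovers [n] bits of a path from the index [i] of its first [level e] bits. *)
Definition decode (i n t : nat) : option bstring :=
  if existsb (fun m => (level (fst m) =? length (dec i)) && (n <=? snd m)) (snd (stage U good t))
  then match find (fun sigma => str_eqb (dec i) (firstn (length (dec i)) sigma))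
                  (fst (stage U good t)) with
       | None => None
       | Some sigma => Some (firstn n sigma)
       end
  else None.

Lemma computable_decode : computable3 decode.
Proof. unfold decode. computable. Qed.

Lemma decode_sound X i n t e y :
  path (tree U good) X ->
  dec i = restr X (level e) -> decode i n t = Some y -> y = restr X n.
Proof.
  intros hX hi. unfold decode. rewrite hi, restr_length.
  destruct (existsb _ _) eqn:E; [|discriminate].
  apply existsb_exists in E. destruct E as [m [hm h]].
  apply andb_prop in h. destruct h as [h1 h2].
  apply Nat.eqb_eq in h1. apply Nat.leb_le in h2.
  destruct (find _ _) as [sigma|] eqn:F; [|discriminate].
  apply find_some in F. destruct F as [F1 F2]. apply str_eqbP in F2.
  intros [= <-]. symmetry. apply (path_decode U good X t m); auto.
  rewrite h1. exact F2.
Qed.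

(** The restriction of [X] itself is a candidate for the search among strings, so the presence of
    the marker is all that decoding waits for. *)
Lemma decode_defined X i n t e r :
  path (tree U good) X -> dec i = restr X (level e) ->
  In (e, r) (snd (stage U good t)) -> n <= r -> decode i n t <> None.
Proof.
  intros hX hi hm hn. unfold decode. rewrite hi, restr_length.
  destruct (existsb _ _) eqn:E.
  - destruct (find _ _) eqn:F; [discriminate|].
    exfalso. pose proof (find_none _ _ F _ (path_stage U good X t hX)) as h.
    cbv beta in h. rewrite firstn_restr in h.
    + enough (true = false) by discriminate. rewrite <- h. symmetry. apply str_eqbP. auto.
    + apply (Inv_level U _ _ _ (Inv_stage U good t) hm).
  - exfalso. enough (true = false) by discriminate. rewrite <- E. symmetry.
    apply existsb_exists. exists (e, r). split; auto. simpl.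
    rewrite Nat.eqb_refl. apply Nat.leb_le, hn.
Qed.

End TreeComputable.
#[global] Hint Resolve computable_level : computable.

(** * Guessing where [A] is far more complex than zeros *)

Section Approximation.
Variables (U : code) (hU : optimal_pf U) (A : cantor) (g : nat -> nat -> nat).
Hypothesis hg : forall x, exists s0, forall s, s0 <= s -> g x s = b2n (A x).

Definition approx (s n : nat) : bstring := map (fun x => g x s =? 1) (seq 0 n).

Lemma approx_limit n : exists s0, forall s, s0 <= s -> approx s n = restr A n.
Proof.
  destruct (eventually_all_lt (fun x s => g x s = b2n (A x)) n) as [s0 h0]; [auto|].
  exists s0. intros s hs. apply map_ext_in. intros x hx. apply in_seq in hx.
  rewrite h0 by lia. destruct (A x); auto.
Qed.

Definition zeros (n : nat) : bstring := restr emptyset n.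

(* The gap exceeds, by an unbounded amount, the index of any string of length [level e]. *)
Definition gap (e : nat) : nat := pow2 (S (level e)) + e.

(** Here [k] is an upper bound for K(0^n) already witnessed. The answer may change back and forth,
    as [approx] changes and as descriptions of it turn up. *)
Definition looks_good (e r s : nat) : bool :=
  existsb (fun n => existsb (fun k =>
      describedb U s (zeros n) k && negb (describedb U s (approx s n) (k + gap e)))
    (seq 0 s)) (seq 0 (S r)).

Lemma computable_looks_good : computable2 g -> computable3 looks_good.
Proof. intros h. unfold looks_good, zeros, restr, emptyset, approx, gap. computable. Qed.

Lemma looks_good_eventually :
  ~ leK U A emptyset ->
  forall e, exists n s0, forall r s, n <= r -> s0 <= s -> looks_good e r s = true.
Proof.
  intros hA e.
  assert (exists n, K U (zeros n) + gap e < K U (restr A n)) as [n hn].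
  { apply NNPP. intros h. apply hA. exists (gap e). intros n.
    destruct (le_lt_dec (K U (restr A n)) (K U (zeros n) + gap e)); auto. exfalso. eauto. }
  destruct (approx_limit n) as [s1 h1].
  destruct (describedb_complete U (zeros n) (K U (zeros n))) as [s2 h2];
    [apply K_le; auto|].
  (* The stage has to exceed K(0^n), since [k] ranges below the stage. *)
  exists n, (S (max (K U (zeros n)) (max s1 s2))). intros r s hr hs.
  apply existsb_exists. exists n. split; [apply in_seq; lia|].
  apply existsb_exists. exists (K U (zeros n)). split; [apply in_seq; lia|].
  rewrite h1, h2 by lia. simpl. apply negb_true_iff.
  destruct (describedb U s (restr A n) (K U (zeros n) + gap e)) eqn:E; auto.
  apply describedb_sound, K_le in E; auto. lia.
Qed.

(** Only finitely many n compete. If each failed, a late stage would show the true A|n with a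
    description of length at most K(0^n) + [gap e]; as a witnessed [k] is at least K(0^n), this
    refutes every [k]. *)
Lemma looks_good_limit e r s0 :
  (forall s, s0 <= s -> looks_good e r s = true) ->
  exists n, n <= r /\ K U (zeros n) + gap e < K U (restr A n).
Proof.
  intros h. apply NNPP. intros hn.
  destruct (eventually_all_lt (fun n s => approx s n = restr A n /\
     describedb U s (restr A n) (K U (zeros n) + gap e) = true) (S r)) as [s1 h1].
  { intros n hr. destruct (approx_limit n) as [s1 h1].
    destruct (describedb_complete U (restr A n) (K U (zeros n) + gap e)) as [s2 h2].
    - apply K_le; auto.
      destruct (le_lt_dec (K U (restr A n)) (K U (zeros n) + gap e)); auto.
      exfalso. apply hn. exists n. split; auto. lia.
    - exists (max s1 s2). intros s hs. split; [apply h1|apply h2]; lia. }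
  specialize (h (max s0 s1) ltac:(lia)).
  apply existsb_exists in h. destruct h as [n [hr h]]. apply in_seq in hr.
  apply existsb_exists in h. destruct h as [k [_ h]].
  apply andb_prop in h. destruct h as [h2 h3].
  apply describedb_sound, K_le in h2; auto.
  destruct (h1 n (max s0 s1)) as [h4 h5]; [lia|lia|].
  rewrite h4 in h3. apply negb_true_iff in h3.
  rewrite (describedb_le U _ _ (K U (zeros n) + gap e)) in h3; auto; [discriminate|lia].
Qed.

End Approximation.

Theorem theorem6p1 :
  forall (U : code), optimal_pf U ->
  forall (A : cantor), Delta02 A -> ~ leK U A emptyset ->
  exists T : bstring -> bool,
    computable_tree T /\
    (exists X, path T X) /\
    (forall X, path T X -> ~ leK U X emptyset /\ ~ leK U A X).
Proof.
  intros U hU A [g [cg [hcg hg]]] hA.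
  assert (hgc : computable2 g).
  { exists (fun n => g (fst (of_nat n)) (snd (of_nat n))). split.
    - apply natcomp_code2 with (h := cg); [auto|apply natcomp_fst|apply natcomp_snd].
    - intros [x s]. unfold encode, enc_prod. rewrite cancel_of_to. reflexivity. }
  set (good := looks_good U g).
  pose proof (computable_looks_good U g hgc) as hgood. fold good in hgood.
  pose proof (permanent_marker U good (looks_good_eventually U hU A g hg hA)) as hperm.
  exists (tree U good). split; [apply tree_computable; auto|]. split.
  { apply konig; [intros s t; apply tree_closed; auto|apply tree_infinite; auto]. }
  intros X hX. split.
  - intros [c hc].
    destruct (described_family U hU (fun e => zeros (level e))) as [c1 h1].
    { unfold zeros, restr, emptyset. computable. }
    (* With e at least c1 + c, K-triviality would give complexity at most e + c1 + c, hence at most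
       2e, to a string that the permanent marker removes. *)
    destruct (hperm (c1 + c)) as (e & r & s0 & he & h).
    destruct (describedb_complete U (restr X (level e)) (e + e)) as [s1 h2].
    { apply K_le; auto. specialize (hc (level e)). specialize (h1 e).
      apply K_le in h1; auto. unfold zeros in h1. lia. }
    destruct (h (max s0 s1)) as [hm _]; [lia|].
    apply (path_not_described U good X _ _ hX) in hm. simpl in hm.
    rewrite h2 in hm by lia. discriminate.
  - intros [c hc].
    destruct (describe U hU (decode U good)) as [c1 h1]; [apply computable_decode; auto|].
    (* The summand e of the gap absorbs the decoder constant [c1] and the reduction constant [c];
       the power of two absorbs the index [i]. *)
    destruct (hperm (S (c1 + c))) as (e & r & s0 & he & h).
    destruct (looks_good_limit U hU A g hg e r s0) as (n & hn & hK).
    { intros s hs. apply h, hs. }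
    (* A shortest program for 0^n; the length of its output hands [n] to the decoder. *)
    destruct (proj1 (K_le U hU (zeros n) _) (le_n _)) as (q & hq & hlen).
    pose (i := enc (restr X (level e))).
    assert (hi : dec i = restr X (level e)) by apply dec_enc.
    destruct (h1 i q (zeros n) hq) as (t & y & q' & hy & hq' & hlen').
    { exists s0. intros t ht. unfold zeros. rewrite restr_length.
      apply (decode_defined U good X i n t e r); auto. apply h, ht. }
    unfold zeros in hy. rewrite restr_length in hy.
    apply (decode_sound U good X i n t e y) in hy; auto. subst y.
    assert (K U (restr X n) <= i + length q + c1) by (apply K_le; auto; exists q'; auto).
    pose proof (enc_bound (restr X (level e))) as hb. rewrite restr_length in hb.
    specialize (hc n). unfold gap in hK. fold i in hb. lia.
Qed.
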